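(* For the complex Banach space $X=\ell_1\oplus_\infty c_0$, the set of numerical radius attaining compact operators is dense in $\mathcal{K}(X)$, but $X$ fails the BPBp-nu for compact operators.
   Context: $\mathcal{K}(X)$ is the space of compact linear operators from $X$ to $X$ with the operator norm. $\ell_1\oplus_\infty c_0$ is $\ell_1\times c_0$ (complex sequence spaces) with norm $\max\{\|x\|_1,\|y\|_\infty\}$. For a Banach space $X$ with unit sphere $S_X$ and dual $X^*$, put $\Pi(X)=\{(x,x^* )\in S_X\times S_{X^*}: x^*(x)=1\}$ and, for a bounded operator $T$ on $X$, $\nu(T)=\sup\{|x^*(Tx)|:(x,x^* )\in\Pi(X)\}$ (the numerical radius). $T$ attains its numerical radius if there is $(x_0,x_0^* )\in\Pi(X)$ with $|x_0^*(Tx_0)|=\nu(T)$. BPBp-nu for compact operators: $X$ has this property if for every $0<\varepsilon<1$ there exists $\eta(\varepsilon)>0$ such that whenever $T\in\mathcal{K}(X)$ and $(x_0,x_0^* )\in\Pi(X)$ satisfy $\nu(T)=1$ and $|x_0^*(Tx_0)|>1-\eta(\varepsilon)$, there exist $S\in\mathcal{K}(X)$ and $(x_1,x_1^* )\in\Pi(X)$ such that $\nu(S)=|x_1^*(Sx_1)|=1$, $\|S-T\|<\varepsilon$, $\|x_1-x_0\|<\varepsilon$ and $\|x_1^*-x_0^*\|<\varepsilon$. *)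

(* Defs.v *)
From HB Require Import structures.
From mathcomp Require Import all_boot all_order all_algebra.
From mathcomp Require Import complex.
From mathcomp Require Import all_classical all_reals all_analysis.

Set Implicit Arguments.
Unset Strict Implicit.
Unset Printing Implicit Defensive.

Import Order.TTheory GRing.Theory Num.Theory.
Import numFieldNormedType.Exports.

Local Open Scope classical_set_scope.
Local Open Scope ring_scope.
Local Open Scope complex_scope.

Section numerical_radius.
Context {R : realType}.

(* The norm of a normed module over R[i] takes its values in R[i]; they are
   real, and rnorm is the same norm with values in R (see rnormE). *)
Definition rnorm {V : normedModType R[i]} (x : V) : R := complex.Re `|x|.

Lemma rnormE {V : normedModType R[i]} (x : V) : (rnorm x)%:C = `|x|.
Proof. by rewrite RRe_real// ger0_real. Qed.

Lemma rnorm_ge0 {V : normedModType R[i]} (x : V) : 0 <= rnorm x.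
Proof. by rewrite -ler0c rnormE. Qed.

Lemma rnormD {V : normedModType R[i]} (x y : V) :
  rnorm (x + y) <= rnorm x + rnorm y.
Proof. by rewrite -lecR rmorphD/= !rnormE ler_normD. Qed.

Lemma rnormZ {V : normedModType R[i]} (a : R[i]) (x : V) :
  rnorm (a *: x) = rnorm (a : R[i]^o) * rnorm x.
Proof. by apply: complexI; rewrite rmorphM/= !rnormE normrZ. Qed.

Lemma rnorm0_eq0 {V : normedModType R[i]} (x : V) : rnorm x = 0 -> x = 0.
Proof. by move=> x0; apply/normr0_eq0; rewrite -rnormE x0. Qed.

(* Meaningful for bounded operators only: sup is 0 on sets which are not
   bounded above. The argument is a bare function, so that opnorm applies to
   differences S \- T. *)
Definition opnorm {V W : normedModType R[i]} (T : V -> W) : R :=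
  sup [set rnorm (T x) | x in [set x : V | rnorm x <= 1]].

Definition compact_op {V W : normedModType R[i]} (T : {linear V -> W}) : Prop :=
  precompact (T @` [set x : V | rnorm x <= 1]).

Context {X : normedModType R[i]}.

(* X^* is the set of continuous linear functionals, with norm opnorm; R[i]^o is
   R[i] as a normed space over itself. *)
Definition Pi : set (X * {linear X -> R[i]^o}) :=
  [set p : X * {linear X -> R[i]^o} |
    [/\ rnorm p.1 = 1, continuous p.2, opnorm p.2 = 1 & p.2 p.1 = 1]].

Definition numerical_radius (T : {linear X -> X}) : R :=
  sup [set rnorm (p.2 (T p.1)) | p in Pi].

Definition attains_numerical_radius (T : {linear X -> X}) : Prop :=
  exists x0 x0', Pi (x0, x0') /\ rnorm (x0' (T x0)) = numerical_radius T.

End numerical_radius.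

(* Density for the operator norm in the space of compact operators. *)
Definition compact_NRA_dense {R : realType} (X : normedModType R[i]) : Prop :=
  forall T : {linear X -> X}, compact_op T ->
  forall e : R, 0 < e ->
  exists S : {linear X -> X},
    [/\ compact_op S, attains_numerical_radius S & opnorm (S \- T) < e].

Definition compact_BPBp_nu {R : realType} (X : normedModType R[i]) : Prop :=
  forall e : R, 0 < e < 1 ->
  exists2 eta : R, 0 < eta &
  forall (T : {linear X -> X}) (x0 : X) (x0' : {linear X -> R[i]^o}),
    compact_op T -> Pi (x0, x0') ->
    numerical_radius T = 1 -> rnorm (x0' (T x0)) > 1 - eta ->
  exists (S : {linear X -> X}) (x1 : X) (x1' : {linear X -> R[i]^o}),
    [/\ compact_op S, Pi (x1, x1'),
        numerical_radius S = 1 /\ rnorm (x1' (S x1)) = 1 &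
        [/\ opnorm (S \- T) < e, rnorm (x1 - x0) < e &
            opnorm (x1' \- x0') < e]].

Section sequence_spaces.
Variable R : realType.
Implicit Types (a : R[i]).

Definition l1_seq : {pred (nat -> R[i]^o)} :=
  mem [set x | cvgn (series (fun n => rnorm (x n)))].

Definition c0_seq : {pred (nat -> R[i]^o)} :=
  mem [set x | x @ \oo --> (0 : R[i]^o)].

Lemma l1_seq_submod : submod_closed l1_seq.
Proof.
split=> [|a x y]; rewrite !inE /=.
  rewrite (_ : series _ = cst 0); first exact: is_cvg_cst.
  by apply/funext => n; rewrite /series/= big1// => i _; rewrite /rnorm normr0.
move=> cx cy.
apply: (@series_le_cvg _ _
    (rnorm (a : R[i]^o) *: (fun n => rnorm (x n)) + (fun n => rnorm (y n)))).
- by move=> n; exact: rnorm_ge0.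
- by move=> n; rewrite addr_ge0// ?mulr_ge0 ?rnorm_ge0.
- by move=> n /=; rewrite (le_trans (rnormD _ _))// rnormZ.
- by apply: is_cvg_seriesD => //; exact: is_cvg_seriesZ.
Qed.

Lemma c0_seq_submod : submod_closed c0_seq.
Proof.
split=> [|a x y]; rewrite !inE /=; first exact: cvg_cst.
move=> x0 y0; suff -> : (0 : R[i]^o) = a *: 0 + 0.
  exact: (@cvgD _ R[i]^o _ _ _ (a *: x) y _ _ (cvgZr x0) y0).
by rewrite scaler0 addr0.
Qed.

HB.instance Definition _ :=
  GRing.isSubmodClosed.Build R[i] (nat -> R[i]^o) l1_seq l1_seq_submod.
HB.instance Definition _ :=
  GRing.isSubmodClosed.Build R[i] (nat -> R[i]^o) c0_seq c0_seq_submod.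

Record l1 : Type := L1 { l1_val :> nat -> R[i]^o; _ : l1_val \in l1_seq }.
Record c0 : Type := C0 { c0_val :> nat -> R[i]^o; _ : c0_val \in c0_seq }.

HB.instance Definition _ := [isSub for l1_val].
HB.instance Definition _ := [Choice of l1 by <:].
HB.instance Definition _ := [SubChoice_isSubLmodule of l1 by <:].
HB.instance Definition _ := [isSub for c0_val].
HB.instance Definition _ := [Choice of c0 by <:].
HB.instance Definition _ := [SubChoice_isSubLmodule of c0 by <:].

Lemma l1_valD (x y : l1) n : (x + y) n = x n + y n.
Proof. by []. Qed.

Lemma l1_valZ a (x : l1) n : (a *: x) n = a *: x n.
Proof. by []. Qed.

Lemma c0_valD (x y : c0) n : (x + y) n = x n + y n.
Proof. by []. Qed.

Lemma c0_valZ a (x : c0) n : (a *: x) n = a *: x n.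
Proof. by []. Qed.

Definition l1_norm (x : l1) : R[i] :=
  (limn (series (fun n => rnorm (x n))))%:C.

Definition c0_norm (x : c0) : R[i] := (sup (range (fun n => rnorm (x n))))%:C.

Lemma l1_cvg (x : l1) : cvgn (series (fun n => rnorm (x n))).
Proof. by have := valP x; rewrite inE. Qed.

Lemma l1_normD (x y : l1) : l1_norm (x + y) <= l1_norm x + l1_norm y.
Proof.
rewrite /l1_norm -rmorphD/= lecR -(lim_seriesD (@l1_cvg x) (@l1_cvg y)).
have cD : cvgn (series ((fun n => rnorm (x n)) + (fun n => rnorm (y n)))).
  by apply: is_cvg_seriesD; exact: l1_cvg.
apply: (lim_series_le (@l1_cvg (x + y)) cD) => n.
by rewrite [leLHS]/=; exact: rnormD.
Qed.

Lemma l1_normZ a (x : l1) : l1_norm (a *: x) = `|a| * l1_norm x.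
Proof.
rewrite -[`|a|](@rnormE _ R[i]^o) /l1_norm -rmorphM/=; congr (_%:C).
rewrite -[RHS](lim_seriesZ _ (@l1_cvg x)); congr (limn (series _)).
by apply/funext => n; rewrite /= rnormZ.
Qed.

Lemma l1_norm0_eq0 (x : l1) : l1_norm x = 0 -> x = 0.
Proof.
move=> /complexI x0; apply/val_inj/funext => n; apply/rnorm0_eq0/le_anti.
rewrite rnorm_ge0 andbT -[leRHS]x0.
apply: le_trans (nondecreasing_cvgn_le _ (@l1_cvg x) n.+1); last first.
  by apply: nondecreasing_series => k _ _; exact: rnorm_ge0.
by rewrite seriesSr lerDr sumr_ge0// => i _; exact: rnorm_ge0.
Qed.

Lemma c0_ubound (x : c0) : has_ubound (range (fun n => rnorm (x n))).
Proof.
have cx : cvgn (x : nat -> R[i]^o).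
  by apply: (@cvgP _ _ 0); have := valP x; rewrite inE.
have pf := @globally_properfilter nat setT 0%N I.
have /ex_bound[M xM] := cvg_seq_bounded cx.
exists (complex.Re M) => _ [n _ <-].
by have /= := xM n I; rewrite lecE => /andP[].
Qed.

Lemma c0_le_norm (x : c0) n : rnorm (x n) <= sup (range (fun n => rnorm (x n))).
Proof. by apply: ub_le_sup; [exact: c0_ubound|exists n]. Qed.

Lemma c0_normD (x y : c0) : c0_norm (x + y) <= c0_norm x + c0_norm y.
Proof.
rewrite /c0_norm -rmorphD/= lecR.
apply: ge_sup; first by exists (rnorm ((x + y) 0%N)), 0%N.
move=> _ [n _ <-]; apply: (le_trans (rnormD (x n) (y n))).
by apply: lerD; exact: c0_le_norm.
Qed.

Lemma c0_normZ a (x : c0) : c0_norm (a *: x) = `|a| * c0_norm x.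
Proof.
rewrite -[`|a|](@rnormE _ R[i]^o) /c0_norm -rmorphM/=; congr (_%:C).
have le1 b (y : c0) : sup (range (fun n => rnorm ((b *: y) n))) <=
    rnorm (b : R[i]^o) * sup (range (fun n => rnorm (y n))).
  apply: ge_sup; first by exists (rnorm ((b *: y) 0%N)), 0%N.
  move=> _ [n _ <-]; rewrite [leLHS]/= rnormZ.
  by rewrite ler_wpM2l ?rnorm_ge0//; exact: c0_le_norm.
apply/le_anti; rewrite le1/=; have [->|a0] := eqVneq a 0.
  rewrite (_ : rnorm (0 : R[i]^o) = 0) ?mul0r; last by rewrite /rnorm normr0.
  exact: le_trans (rnorm_ge0 _) (@c0_le_norm (0 *: x) 0%N).
have na0 : 0 < rnorm (a : R[i]^o).
  by rewrite lt0r rnorm_ge0 andbT; apply: contra a0 => /eqP/rnorm0_eq0 ->.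
rewrite -ler_pdivlMl//; have := le1 a^-1 (a *: x); rewrite scalerK//.
congr (_ <= _ * _); apply: complexI.
by rewrite rnormE fmorphV/= rnormE normfV.
Qed.

Lemma c0_norm0_eq0 (x : c0) : c0_norm x = 0 -> x = 0.
Proof.
move=> /complexI x0; apply/val_inj/funext => n; apply/rnorm0_eq0/le_anti.
by rewrite rnorm_ge0 andbT -[leRHS]x0; exact: c0_le_norm.
Qed.

(* With these instances, l1 * c0 carries the product norm of the library, which
   is the maximum of the two norms (prod_normE). *)
HB.instance Definition _ :=
  Lmodule_isNormed.Build R[i] l1 l1_normD l1_normZ l1_norm0_eq0.
HB.instance Definition _ :=
  Lmodule_isNormed.Build R[i] c0 c0_normD c0_normZ c0_norm0_eq0.

End sequence_spaces.

(* Main.v *)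
Require Import Defs.
From HB Require Import structures.
From mathcomp Require Import all_boot all_order all_algebra.
From mathcomp Require Import complex.
From mathcomp Require Import all_classical all_reals all_analysis.
From mathcomp Require Import ring lra.

(* Density. The unit ball of l1 is the closed convex hull of the unimodular
   multiples of the unit vectors e_j, so |S| = sup_{j, y} |S (e_j, y)|, and any
   (e_j, y) attaining this supremum yields a state at which S attains its
   numerical radius. To make it attained, first replace T (x, y) by
   T (x, y_0, ..., y_{m-1}), which is close to T because T is compact and blocks
   of c0 with disjoint supports can be added at no cost; then add a small
   rank-one operator z |-> d z.1_{j0} g which makes one column j0 strictly
   dominate the others; the maximum over y is now taken on a compact set.

   Failure. Let T_n (x, y) = (0, A x), where A is the n x n matrix with zeros on
   the diagonal and ones elsewhere, and take x = (1/n, ..., 1/n),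
   y = (1, ..., 1), y^* = (1/n, ..., 1/n), so that y^* (A x) = 1 - 1/n while
   nu(T_n) = 1. If S is close to T_n and attains nu(S) = 1 at a nearby state
   ((a, b), f), then for every i in the supports of both a and f (0, .) the i-th
   c0-coordinate of S (c e_i, b) has modulus 1 for a unit scalar c. Some such i
   is below n because both supports carry most of {0, ..., n-1}, whereas the
   i-th c0-coordinate of T_n (c e_i, b) is then 0. *)

Set Implicit Arguments.
Unset Strict Implicit.
Unset Printing Implicit Defensive.

Import Order.TTheory GRing.Theory Num.Theory.
Import numFieldNormedType.Exports.

Local Open Scope classical_set_scope.
Local Open Scope ring_scope.
Local Open Scope complex_scope.

(** * Real-valued norms and compactness *)

Section real_norm.
Context {R : realType}.
Implicit Types V W : normedModType R[i].

Lemma rnorm0 V : rnorm (0 : V) = 0.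
Proof. by rewrite /rnorm normr0. Qed.

Lemma rnormN V (x : V) : rnorm (- x) = rnorm x.
Proof. by rewrite /rnorm normrN. Qed.

Lemma rnormB V (x y : V) : rnorm (x - y) <= rnorm x + rnorm y.
Proof. by rewrite -[rnorm y]rnormN rnormD. Qed.

Lemma rnorm_sum V (I : Type) (s : seq I) (P : pred I) (F : I -> V) :
  rnorm (\sum_(i <- s | P i) F i) <= \sum_(i <- s | P i) rnorm (F i).
Proof.
elim/big_ind2 : _ => [|x1 x2 y1 y2 h1 h2|//]; first by rewrite rnorm0.
exact: le_trans (rnormD _ _) (lerD h1 h2).
Qed.

Lemma rnorm_dist V (x y : V) : `|rnorm x - rnorm y| <= rnorm (x - y).
Proof.
rewrite ler_norml; apply/andP; split.
  by rewrite lerBrDl lerBlDr -[rnorm (x - y)]rnormN opprB addrC -{1}(subrK x y)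
    rnormD.
by rewrite lerBlDr -{1}(subrK y x) rnormD.
Qed.

Lemma rnorm_prod V W (x : (V * W)%type) :
  rnorm x = Num.max (rnorm x.1) (rnorm x.2).
Proof.
apply: complexI; rewrite rnormE prod_normE /= -!rnormE.
by rewrite /Order.max ltcR; case: ifP.
Qed.

Lemma near_rnorm_lt V (x : V) (e : R) :
  0 < e -> \forall y \near x, rnorm (x - y) < e.
Proof.
move=> e0; have := @cvgr_dist_lt _ _ _ (nbhs x) _ id x (@cvg_id _ _) e%:C.
rewrite ltcR => /(_ _ e0); apply: filterS => y /=.
by rewrite -rnormE ltcR.
Qed.

Lemma rnorm_continuous V : continuous (@rnorm R V).
Proof.
move=> x; apply/cvgrPdist_lt => e e0.
by apply: filterS (near_rnorm_lt x e0) => y; exact/le_lt_trans/rnorm_dist.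
Qed.

Lemma rnormc1 : rnorm (1 : R[i]^o) = 1.
Proof. by rewrite /rnorm normr1. Qed.

Lemma rnormcM (a b : R[i]) :
  rnorm (a * b : R[i]^o) = rnorm (a : R[i]^o) * rnorm (b : R[i]^o).
Proof. exact: rnormZ. Qed.

Lemma rnormcR (r : R) : rnorm (r%:C : R[i]^o) = `|r|.
Proof. by rewrite /rnorm normc_def /= expr0n addr0 sqrtr_sqr. Qed.

Lemma ler_Re_rnorm (a : R[i]) : complex.Re a <= rnorm (a : R[i]^o).
Proof.
rewrite -lecR rnormE; apply: le_trans (normc_ge_Re a).
by rewrite lecR ler_norm.
Qed.

Lemma rnormcV (u : R[i]) : rnorm (u^-1 : R[i]^o) = (rnorm (u : R[i]^o))^-1.
Proof. by apply: complexI; rewrite rnormE fmorphV/= rnormE normfV. Qed.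

Lemma exists_phase (a : R[i]) :
  exists2 u : R[i]^o, rnorm u = 1 & u * a = (rnorm (a : R[i]^o))%:C.
Proof.
have [->|a0] := eqVneq a 0; first by exists 1; rewrite ?rnormc1// mulr0 rnorm0.
exists ((rnorm (a : R[i]^o))%:C / a); last by rewrite divfK.
rewrite rnormcM rnormcR rnormcV ger0_norm ?rnorm_ge0// divff//.
by apply: contra a0 => /eqP/rnorm0_eq0 ->.
Qed.

Lemma rnorm_unit_neq0 (u : R[i]^o) : rnorm u = 1 -> u != 0.
Proof.
by move=> u1; apply/eqP => u0; move: u1 => /eqP;
  rewrite u0 rnorm0 eq_sym oner_eq0.
Qed.

(** Rotating [b] onto the ray of [a] turns the triangle inequality into an equality. In this way a
    bound on a functional becomes a bound on a sum of moduli. *)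
Lemma exists_phase_add (a b : R[i]) : exists2 u : R[i]^o, rnorm u = 1 &
  rnorm (a + u * b : R[i]^o) = rnorm (a : R[i]^o) + rnorm (b : R[i]^o).
Proof.
have [u u1 ua] := exists_phase a; have [v v1 vb] := exists_phase b.
exists (u^-1 * v); first by rewrite rnormcM rnormcV u1 v1 invr1 mulr1.
rewrite -[LHS]mul1r -u1 -rnormcM mulrDr ua !mulrA divff ?rnorm_unit_neq0//.
by rewrite mul1r vb -rmorphD/= rnormcR ger0_norm// addr_ge0// rnorm_ge0.
Qed.

Lemma compact_disc : compact [set a : R[i]^o | rnorm a <= 1].
Proof.
pose f (p : R * R) : R[i]^o := p.1%:C + 'i * p.2%:C.
have i1 : rnorm ('i : R[i]^o) = 1.
  by rewrite /rnorm normc_def/= expr0n add0r expr1n sqrtr1.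
have iE r : rnorm ('i * r%:C : R[i]^o) = `|r|.
  by rewrite rnormcM rnormcR i1 mul1r.
have cf : continuous f.
  move=> p; apply/(@cvgrPdist_lt _ R[i]^o _ (nbhs p)) => e e0.
  have eE : e = (complex.Re e)%:C by rewrite RRe_real// gtr0_real.
  have {}e0 : 0 < complex.Re e by rewrite -ltcR -eE.
  have e20 : 0 < complex.Re e / 2 by rewrite divr_gt0.
  near=> q; rewrite eE -[X in X < _](@rnormE _ R[i]^o) ltcR.
  have -> : f p - f q = (p.1 - q.1)%:C + 'i * (p.2 - q.2)%:C.
    by rewrite /f !rmorphB/= mulrBr opprD addrACA.
  apply: (le_lt_trans (rnormD (_ : R[i]^o) _)).
  rewrite rnormcR iE (splitr (complex.Re e)); apply: ltrD.
    by near: q; apply: (@cvgr_dist_lt _ _ _ _ _ _ _ (@cvg_fst _ _ _ _ _)).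
  by near: q; apply: (@cvgr_dist_lt _ _ _ _ _ _ _ (@cvg_snd _ _ _ _ _)).
(* The disc is a closed subset of the image of the compact square [-1, 1]^2. *)
have cK : compact (f @` (`[-1, 1] `*` `[-1, 1])).
  apply: continuous_compact; first exact: continuous_subspaceT.
  by apply: compact_setX; exact: segment_compact.
apply: (subclosed_compact _ cK).
  apply: (@closed_comp _ _ rnorm [set r | r <= 1]); last exact: closed_le.
  by move=> x _; exact: rnorm_continuous.
move=> a /= a1; exists (complex.Re a, complex.Im a) => /=;
  last by rewrite /f -complexE.
have reb (b : R[i]) : rnorm (b : R[i]^o) <= 1 -> `|complex.Re b| <= 1.
  by apply: le_trans; rewrite -lecR rnormE; exact: normc_ge_Re.
split=> /=; rewrite in_itv/= -ler_norml; first exact: reb.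
by rewrite -normrN -(ReiNIm a) reb// mulrC rnormcM i1 mul1r.
Unshelve. all: by end_near. Qed.

(** These sets supply all the finite-dimensional compactness below: the image of the ball under a
    matrix operator, a rank-one perturbation, and the truncated ball of c0. *)
Definition disc_combinations V (e : nat -> V) n : set V :=
  [set y | exists2 a : nat -> R[i]^o, (forall k, rnorm (a k) <= 1) &
           y = \sum_(k < n) a k *: e k].

Lemma compact_disc_combinations V (e : nat -> V) n :
  compact (disc_combinations e n).
Proof.
elim: n => [|n IH].
  rewrite (_ : disc_combinations e 0 = [set 0]); first exact: compact_set1.
  apply/seteqP; split=> [_ [a _ ->]|_ ->] /=; first by rewrite big_ord0.
  by exists (fun=> 0); rewrite ?big_ord0// => k; rewrite rnorm0.
pose f (p : V * R[i]^o) : V := p.1 + p.2 *: e n.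
have -> : disc_combinations e n.+1 =
    f @` (disc_combinations e n `*` [set a | rnorm a <= 1]).
  apply/seteqP; split=> [_ [a a1 ->]|_ [[y b] [[a a1 /= ->] b1] <-]].
    exists (\sum_(k < n) a k *: e k, a n); first by split => //=; exists a.
    by rewrite /f big_ord_recr.
  exists (fun k => if (k < n)%N then a k else b) => [k|]; first by case: ifP.
  rewrite big_ord_recr/= ltnn; congr (_ + _).
  by apply: eq_bigr => k _; rewrite ltn_ord.
apply: continuous_compact; last exact: compact_setX IH compact_disc.
apply: continuous_subspaceT => p; apply: cvgD; first exact: cvg_fst.
by apply: (@cvgZr_tmp _ V); exact: cvg_snd.
Qed.

End real_norm.

(** * Bounded and compact operators, states *)

Section operators.
Context {R : realType}.
Implicit Types V W X : normedModType R[i].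

(** The bound [K] excludes the default value 0 that [sup] takes on unbounded sets. *)
Lemma opnorm_ub V W (f : V -> W) (K : R) :
  (forall x, rnorm x <= 1 -> rnorm (f x) <= K) ->
  forall x, rnorm x <= 1 -> rnorm (f x) <= opnorm f.
Proof.
move=> fK x x1; apply: ub_le_sup; last by exists x.
by exists K => _ [y y1 <-]; exact: fK.
Qed.

Lemma opnorm_le V W (f : V -> W) (K : R) :
  (forall x, rnorm x <= 1 -> rnorm (f x) <= K) -> opnorm f <= K.
Proof.
move=> fK; apply: ge_sup; last by move=> _ [y y1 <-]; exact: fK.
by exists (rnorm (f 0)), 0 => //=; rewrite rnorm0.
Qed.

Lemma linear_rnorm_le V W (f : {linear V -> W}) (K : R) :
  (forall x, rnorm x <= 1 -> rnorm (f x) <= K) ->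
  forall x, rnorm (f x) <= K * rnorm x.
Proof.
move=> fK x; have [->|x0] := eqVneq x 0; first by rewrite linear0 !rnorm0 mulr0.
have nx0 : rnorm x != 0 by apply: contra x0 => /eqP/rnorm0_eq0 ->.
have nx : 0 < rnorm x by rewrite lt0r nx0 rnorm_ge0.
have := fK ((rnorm x)^-1%:C *: x).
rewrite linearZ !rnormZ rnormcR ger0_norm ?invr_ge0 ?rnorm_ge0// mulVf//.
by move=> /(_ (lexx _)); rewrite mulrC ler_pdivrMr.
Qed.

Lemma linear_bounded_op_continuous V W (f : {linear V -> W}) (K : R) :
  (forall x, rnorm x <= 1 -> rnorm (f x) <= K) -> continuous f.
Proof.
move=> fK; apply/bounded_linear_continuous/bounded_funP => r.
exists (K * complex.Re r)%:C => x; rewrite -!rnormE.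
have K0 : 0 <= K by apply: le_trans (fK 0 _); rewrite ?rnorm_ge0// rnorm0.
rewrite lecE => /andP[_ /= xr]; rewrite lecR.
exact: le_trans (linear_rnorm_le fK x) (ler_wpM2l K0 xr).
Qed.

Lemma continuous_linear_op_bounded V W (f : {linear V -> W}) : continuous f ->
  exists K : R, forall x, rnorm x <= 1 -> rnorm (f x) <= K.
Proof.
move=> /linear_bounded_continuous/bounded_funP/(_ 1)[M fM].
exists (complex.Re M) => x x1.
have := fM x; rewrite -!rnormE (lecR _ 1) => /(_ x1).
by rewrite lecE => /andP[].
Qed.

Lemma compact_op_bounded V W (T : {linear V -> W}) : compact_op T ->
  exists K : R, forall x, rnorm x <= 1 -> rnorm (T x) <= K.
Proof.
move=> [A TA [cA _]].
have A0 : A !=set0.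
  by exists (T 0); apply: TA; exists 0 => //=; rewrite rnorm0.
have cn : {within A, continuous (@rnorm R W)}.
  exact/continuous_subspaceT/rnorm_continuous.
have [c _ cmax] := compact_EVT_max A0 cA cn.
by exists (rnorm c) => x x1; apply/cmax/mem_set/TA; exists x.
Qed.

Lemma compact_op_subset V W (T : {linear V -> W}) (K : set W) : compact K ->
  (forall x, rnorm x <= 1 -> K (T x)) -> compact_op T.
Proof.
move=> cK TK; apply: (@precompact_subset _ _ K).
  by move=> _ [x x1 <-]; exact: TK.
by apply: compact_precompact => //; exact: norm_hausdorff.
Qed.

(** The image of the unit ball under [S] lies in the sum of two compact sets, one containing the
    image of the ball under [T] and the other being [K]. *)
Lemma compact_op_add V V' W (T : {linear V' -> W}) (S : {linear V -> W})
    (f : V -> V') (K : set W) : compact_op T -> compact K ->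
  (forall x, rnorm x <= 1 -> rnorm (f x) <= 1 /\ K (S x - T (f x))) ->
  compact_op S.
Proof.
move=> [A TA [cA _]] cK SK.
apply: (@compact_op_subset _ _ _ ((fun p => p.1 + p.2) @` (A `*` K))).
  apply: continuous_compact; last exact: compact_setX.
  by apply: continuous_subspaceT => p; apply: cvgD;
    [exact: cvg_fst|exact: cvg_snd].
move=> x x1; have [fx Kx] := SK _ x1.
exists (T (f x), S x - T (f x)); last by rewrite /= addrC subrK.
by split => //=; apply: TA; exists (f x).
Qed.

(** The point [w] is a cluster point of the images; it stands in for the limit of a convergent
    subsequence. *)
Lemma compact_op_cluster V W (T : {linear V -> W}) (x : nat -> V) :
  compact_op T -> (forall n, rnorm (x n) <= 1) ->
  exists w, forall e : R, 0 < e -> forall N,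
    exists2 n, (N <= n)%N & rnorm (w - T (x n)) < e.
Proof.
move=> [A TA [cA _]] x1.
have FA : \forall n \near \oo, A (T (x n)).
  by apply: filterE => n; apply: TA; exists (x n); first exact: x1.
have [w [_ cw]] := cA ((T \o x) @ \oo) _ FA.
exists w => e e0 N.
have FN : \forall k \near \oo,
    [set T (x n) | n in [set n | (N <= n)%N]] (T (x k)).
  by exists N => // n /= Nn; exists n.
by have [_ [[n /= Nn <-] wn]] := cw _ _ FN (near_rnorm_lt w e0); exists n.
Qed.

Lemma exists_linear V W (f : V -> W) : linear f ->
  exists L : {linear V -> W}, forall x, L x = f x.
Proof.
move=> lf.
pose L : {linear V -> W} := HB.pack f (GRing.isLinear.Build _ _ _ _ f lf).
by exists L.
Qed.

(** The bound gives continuity and norm at most 1; the value 1 at a unit vector gives norm at least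
    1. *)
Lemma PiP X (x : X) (f : {linear X -> R[i]^o}) : rnorm x = 1 -> f x = 1 ->
  (forall y, rnorm (f y) <= rnorm y) -> Pi (x, f).
Proof.
move=> x1 fx f1.
have fle y : rnorm y <= 1 -> rnorm (f y) <= 1 by exact: le_trans (f1 y).
split => //=; first exact: linear_bounded_op_continuous fle.
apply/le_anti; rewrite opnorm_le//=.
by rewrite -{1}rnormc1 -fx; apply: opnorm_ub fle _ _; rewrite x1.
Qed.

Lemma Pi_rnorm_le X (x : X) (f : {linear X -> R[i]^o}) : Pi (x, f) ->
  forall y, rnorm (f y) <= rnorm y.
Proof.
move=> [/= _ cf f1 _] y.
have [K fK] := continuous_linear_op_bounded cf.
have := linear_rnorm_le (opnorm_ub fK) y.
by rewrite f1 mul1r.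
Qed.

Lemma numerical_radius_ub X (T : {linear X -> X}) (K : R)
    (x : X) (f : {linear X -> R[i]^o}) :
  (forall x, rnorm x <= 1 -> rnorm (T x) <= K) -> Pi (x, f) ->
  rnorm (f (T x)) <= numerical_radius T.
Proof.
move=> TK xf; apply: ub_le_sup; last by exists (x, f).
exists K => _ [[y g] yg <-] /=; apply: (le_trans (Pi_rnorm_le yg _)).
by apply: TK; case: yg => /= ->.
Qed.

(** The numerical radius never exceeds a norm bound, so one state that reaches such a bound
    determines it. *)
Lemma numerical_radius_eq X (T : {linear X -> X}) (K : R)
    (x : X) (f : {linear X -> R[i]^o}) :
  (forall x, rnorm x <= 1 -> rnorm (T x) <= K) -> Pi (x, f) ->
  rnorm (f (T x)) = K -> numerical_radius T = K.
Proof.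
move=> TK xf fTK; apply/le_anti/andP; split; last first.
  by rewrite -fTK; exact: numerical_radius_ub TK xf.
apply: ge_sup; first by exists (rnorm (f (T x))), (x, f).
move=> _ [[y g] yg <-] /=; apply: (le_trans (Pi_rnorm_le yg _)).
by apply: TK; case: yg => /= ->.
Qed.

End operators.

(** * Unit vectors and truncations in l1 and c0 *)

Section sequences.
Variable R : realType.
Implicit Types (x : l1 R) (y : c0 R).

Lemma rnorm_l1E x : rnorm x = limn (series (fun n => rnorm (x n))).
Proof. by []. Qed.

Lemma l1_psum_le x n : \sum_(k < n) rnorm (x k) <= rnorm x.
Proof.
rewrite rnorm_l1E.
have := nondecreasing_cvgn_le _ (@l1_cvg _ x) n.
rewrite /series/= big_mkord; apply.
by apply: nondecreasing_series => k _ _; exact: rnorm_ge0.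
Qed.

Lemma l1_coord_le x n : rnorm (x n) <= rnorm x.
Proof.
apply: le_trans (l1_psum_le x n.+1).
by rewrite big_ord_recr/= lerDr sumr_ge0// => i _; exact: rnorm_ge0.
Qed.

Lemma l1_rnorm_le x (K : R) :
  (forall n, \sum_(k < n) rnorm (x k) <= K) -> rnorm x <= K.
Proof.
move=> xK; apply: limr_le; first exact: l1_cvg.
by apply: nearW => n; rewrite /series/= big_mkord.
Qed.

Lemma c0_coord_le y n : rnorm (y n) <= rnorm y.
Proof. exact: c0_le_norm. Qed.

Lemma c0_rnorm_le y (K : R) : (forall n, rnorm (y n) <= K) -> rnorm y <= K.
Proof.
by move=> yK; apply: ge_sup; [exists (rnorm (y 0%N)), 0%N|move=> _ [n _ <-]].
Qed.

Lemma l1_valB x x' n : (x - x') n = x n - x' n.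
Proof. by []. Qed.

Lemma c0_valB y y' n : (y - y') n = y n - y' n.
Proof. by []. Qed.

Definition unit_seq (j n : nat) : R[i]^o := if n == j then 1 else 0.

Lemma unit_seq_psum j n : \sum_(k < n) rnorm (unit_seq j k) = (j < n)%:R.
Proof.
elim: n => [|n IH]; first by rewrite big_ord0.
rewrite big_ord_recr/= IH /unit_seq ltnS; case: (ltngtP n j) => h;
  by rewrite ?rnormc1 ?rnorm0 ?addr0 ?add0r.
Qed.

Lemma unit_seq_l1 j : unit_seq j \in @l1_seq R.
Proof.
rewrite inE /=; apply: nondecreasing_is_cvgn.
  by apply: nondecreasing_series => k _ _; exact: rnorm_ge0.
exists 1 => _ [n _ <-]; rewrite /series/= big_mkord unit_seq_psum.
by case: ltnP.
Qed.

Lemma unit_seq_c0 j : unit_seq j \in @c0_seq R.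
Proof.
rewrite inE /=; apply: cvg_near_cst.
by exists j.+1 => // n /= jn; rewrite /unit_seq gtn_eqF.
Qed.

Definition l1_unit j : l1 R := L1 (unit_seq_l1 j).
Definition c0_unit j : c0 R := C0 (unit_seq_c0 j).

Lemma rnorm_l1_unit j : rnorm (l1_unit j) = 1.
Proof.
apply/le_anti/andP; split.
  by apply: l1_rnorm_le => n; rewrite [leLHS](unit_seq_psum j n); case: ltnP.
have := l1_coord_le (l1_unit j) j.
by rewrite [X in rnorm X](_ : _ = 1) ?rnormc1//= /unit_seq eqxx.
Qed.

Lemma l1_unit_shiftE x (a : R[i]) k j :
  (x + a *: l1_unit k) j = if j == k then x j + a else x j.
Proof.
rewrite l1_valD l1_valZ /= /unit_seq /GRing.scale/=.
by case: eqP => _; rewrite ?mulr1 ?mulr0 ?addr0.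
Qed.

Lemma c0_unit_shiftE y (a : R[i]) k j :
  (y + a *: c0_unit k) j = if j == k then y j + a else y j.
Proof.
rewrite c0_valD c0_valZ /= /unit_seq /GRing.scale/=.
by case: eqP => _; rewrite ?mulr1 ?mulr0 ?addr0.
Qed.

Lemma l1_sumE (a : nat -> R[i]) n j :
  (\sum_(k < n) a k *: l1_unit k) j = if (j < n)%N then a j else 0.
Proof.
elim: n => [|n IH]; first by rewrite big_ord0.
rewrite big_ord_recr l1_valD IH l1_valZ /= /unit_seq ltnS.
by case: (ltngtP j n) => [_|_|->];
  rewrite ?scaler0 ?addr0 ?add0r// /GRing.scale/= mulr1.
Qed.

Lemma c0_sumE (a : nat -> R[i]) n j :
  (\sum_(k < n) a k *: c0_unit k) j = if (j < n)%N then a j else 0.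
Proof.
elim: n => [|n IH]; first by rewrite big_ord0.
rewrite big_ord_recr c0_valD IH c0_valZ /= /unit_seq ltnS.
by case: (ltngtP j n) => [_|_|->];
  rewrite ?scaler0 ?addr0 ?add0r// /GRing.scale/= mulr1.
Qed.

Definition l1_trunc n x : l1 R := \sum_(k < n) x k *: l1_unit k.
Definition c0_trunc n y : c0 R := \sum_(k < n) y k *: c0_unit k.

Lemma l1_truncE n x j : l1_trunc n x j = if (j < n)%N then x j else 0.
Proof. exact: l1_sumE. Qed.

Lemma c0_truncE n y j : c0_trunc n y j = if (j < n)%N then y j else 0.
Proof. exact: c0_sumE. Qed.

Lemma l1_trunc_cvg x (e : R) : 0 < e ->
  exists n, rnorm (x - l1_trunc n x) < e.
Proof.
(* Half of [e] is used because bounding all partial sums only yields a weak inequality for the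
   norm. *)
move=> e0; have /cvgrPdist_lt/(_ (e/2)) := @l1_cvg _ x.
rewrite divr_gt0// => /(_ isT)[n _ /(_ n (leqnn n))].
rewrite -rnorm_l1E /series/= big_mkord => xn; exists n.
apply: (@le_lt_trans _ _ (e / 2)); last by rewrite gtr_pMr// invf_lt1// ltr1n.
apply: l1_rnorm_le => m.
apply: le_trans (ltW xn); apply: le_trans (ler_norm _).
have -> : \sum_(k < m) rnorm ((x - l1_trunc n x) k) =
    \sum_(k < m) (if (k < n)%N then 0 else rnorm (x k)).
  apply: eq_bigr => k _; rewrite l1_valB l1_truncE.
  by case: ifP; rewrite ?subrr ?rnorm0// subr0.
rewrite lerBrDr.
have [mn|nm] := leqP m n.
  rewrite [X in X + _]big1 ?add0r; first exact: l1_psum_le.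
  by move=> k _; rewrite (leq_trans (ltn_ord k)).
apply: le_trans (l1_psum_le x m).
rewrite -!(big_mkord xpredT (fun k => rnorm (x k))).
rewrite -(big_mkord xpredT (fun k => if (k < n)%N then 0 else rnorm (x k))).
rewrite !(@big_cat_nat _ _ _ n 0 m)//= ?(ltnW nm)//.
rewrite [X in X + _ + _]big_nat big1 ?add0r; last by move=> k /andP[_ ->].
rewrite [leLHS]addrC; apply: lerD => //; apply: ler_sum_nat => k /andP[nk _].
by rewrite ltnNge nk.
Qed.

Lemma c0_trunc_cvg y (e : R) : 0 < e ->
  exists n, rnorm (y - c0_trunc n y) < e.
Proof.
move=> e0; have : (y : nat -> R[i]^o) @ \oo --> (0 : R[i]^o).
  by have := valP y; rewrite inE.
move=> /cvgrPdist_lt/(_ (e / 2)%:C);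
  rewrite ltcR divr_gt0// => /(_ isT)[n _ yn].
exists n; apply: (@le_lt_trans _ _ (e / 2)); last first.
  by rewrite gtr_pMr// invf_lt1// ltr1n.
apply: c0_rnorm_le => k.
rewrite c0_valB c0_truncE; case: ltnP => [_|nk].
  by rewrite subrr rnorm0 divr_ge0// ltW.
have := yn k nk.
by rewrite sub0r normrN oppr0 addr0 -rnormE ltcR => /ltW.
Qed.

(** Beyond some index the coordinates are bounded by a tail of norm less than [rnorm y], so the
    supremum is a maximum over finitely many coordinates. *)
Lemma c0_rnorm_attained y : 0 < rnorm y -> exists i, rnorm (y i) = rnorm y.
Proof.
move=> y0; have [n yn] := c0_trunc_cvg y y0.
have [//|ny] := pselect (exists i, rnorm (y i) = rnorm y).
have lty i : rnorm (y i) < rnorm y.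
  by rewrite lt_neqAle c0_coord_le andbT; apply/eqP => yi; apply: ny; exists i.
pose M := \big[Num.max/0]_(i < n) rnorm (y i).
(* The default value 0 of the maximum is covered by the positivity of [rnorm y]. *)
have M0 : M < rnorm y by apply: bigmax_lt.
suff : rnorm y <= Num.max M (rnorm (y - c0_trunc n y)).
  by rewrite leNgt gt_max M0 yn.
apply: c0_rnorm_le => k; rewrite le_max; have [kn|nk] := ltnP k n.
  by apply/orP; left; exact: (le_bigmax _ (fun i : 'I_n => rnorm (y i))
    (Ordinal kn)).
apply/orP; right; apply: le_trans (c0_coord_le _ k).
by rewrite c0_valB c0_truncE ltnNge nk subr0.
Qed.

End sequences.

(** * States of l1 (+) c0 *)

Section numerical_radius_l1_c0.
Variable R : realType.
Local Notation X := (l1 R * c0 R)%type.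
Implicit Types (x : l1 R) (y : c0 R) (S : {linear X -> X}).

Lemma rnorm_pair_le x y (K : R) : rnorm x <= K -> rnorm y <= K ->
  rnorm ((x, y) : X) <= K.
Proof. by move=> xK yK; rewrite rnorm_prod ge_max xK yK. Qed.

Lemma rnorm_fst_le (z : X) : rnorm z.1 <= rnorm z.
Proof. by rewrite rnorm_prod le_max lexx. Qed.

Lemma rnorm_snd_le (z : X) : rnorm z.2 <= rnorm z.
Proof. by rewrite rnorm_prod le_max lexx orbT. Qed.

Lemma pairDE x y x' y' : (x, y) + (x', y') = (x + x', y + y') :> X.
Proof. by []. Qed.

Lemma pairZE (a : R[i]) x y : a *: (x, y) = (a *: x, a *: y) :> X.
Proof. by []. Qed.

Lemma linear_l1_coord k : linear (fun z : X => z.1 k : R[i]^o).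
Proof.
move=> a [x y] [x' y']; rewrite pairZE pairDE.
exact: (l1_valD (a *: x) x' k).
Qed.

Lemma linear_c0_coord k : linear (fun z : X => z.2 k : R[i]^o).
Proof.
move=> a [x y] [x' y']; rewrite pairZE pairDE.
exact: (c0_valD (a *: y) y' k).
Qed.

Lemma pair_split x y : (x, y) = (x, 0) + (0, y) :> X.
Proof. by rewrite pairDE addr0 add0r. Qed.

(* The modulus of the affine function t |-> (S (x, y + (t - y k) e_k)).2 k of a
   complex variable is at least its value at t = y k for some t on the unit
   circle; then (x, y + (t - y k) e_k) and t^-1 e_k^* form a state. *)
Lemma exists_state_coord S x y k : rnorm x <= 1 -> rnorm y <= 1 ->
  exists (y' : c0 R) (f : {linear X -> R[i]^o}),
    Pi ((x, y'), f) /\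
    rnorm ((S (x, y)).2 k) <= rnorm (f (S (x, y'))).
Proof.
move=> x1 y1; pose y0 := y - y k *: c0_unit R k.
have yE : y = y0 + y k *: c0_unit R k by rewrite subrK.
pose c := (S (x, y0)).2 k; pose d := (S (0, c0_unit R k)).2 k.
have SE t : (S (x, y0 + t *: c0_unit R k)).2 k = c + t *: d.
  have -> : (x, y0 + t *: c0_unit R k) = (x, y0) + t *: (0, c0_unit R k) :> X.
    by rewrite pairZE pairDE scaler0 addr0.
  by rewrite addrC linearP linear_c0_coord addrC.
have [u u1 ucd] := exists_phase_add c d.
pose y' := y0 + u *: c0_unit R k.
have y'E j : y' j = if j == k then u else y j.
  rewrite /y' /y0 -scaleNr !c0_unit_shiftE.
  by case: eqP => // ->; rewrite subrr add0r.
have [f fE] : exists f : {linear X -> R[i]^o}, forall z, f z = u^-1 * z.2 k.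
  apply: exists_linear => a z1 z2.
  by rewrite linear_c0_coord mulrDr; congr (_ + _); exact: mulrCA.
have fle z : rnorm (f z) <= rnorm z.
  rewrite fE rnormcM rnormcV u1 invr1 mul1r.
  exact: le_trans (c0_coord_le _ _) (rnorm_snd_le _).
have y'k : y' k = u by rewrite y'E eqxx.
have ny' : rnorm y' = 1.
  apply/le_anti/andP; split; last by rewrite -u1 -y'k c0_coord_le.
  apply: c0_rnorm_le => j; rewrite y'E; case: eqP => [_|_]; first by rewrite u1.
  exact: le_trans (c0_coord_le _ _) y1.
exists y', f; split.
  apply: PiP => //; first by rewrite rnorm_prod /= ny'; apply/max_idPr.
  by rewrite fE [X in _ * X]y'k mulVf// rnorm_unit_neq0.
rewrite fE rnormcM rnormcV u1 invr1 mul1r SE [leRHS]ucd {1}yE SE.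
apply: (le_trans (rnormD _ _)); rewrite rnormZ lerD2l ler_piMl ?rnorm_ge0//.
exact: le_trans (c0_coord_le _ _) y1.
Qed.

(** The numerical radius thus controls the c0-coordinates of [S] on the whole unit ball and not only
    at states. *)
Lemma coord_le_numerical_radius S (K : R) (z : X) k :
  (forall z, rnorm z <= 1 -> rnorm (S z) <= K) -> rnorm z <= 1 ->
  rnorm ((S z).2 k) <= numerical_radius S.
Proof.
move=> SK z1; have := @exists_state_coord S z.1 z.2 k.
move=> [||y' [f [Pif]]].
- exact: le_trans (rnorm_fst_le _) z1.
- exact: le_trans (rnorm_snd_le _) z1.
by rewrite -surjective_pairing => /le_trans; apply;
  exact: numerical_radius_ub SK Pif.
Qed.

(** The dual of a max-norm sum carries the sum of the dual norms: after a rotation of [y] the two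
    values add up at a single point of the ball. *)
Lemma Pi_l1_add_c0 (z : X) (f : {linear X -> R[i]^o}) x y : Pi (z, f) ->
  rnorm x <= 1 -> rnorm y <= 1 -> rnorm (f (x, 0)) + rnorm (f (0, y)) <= 1.
Proof.
move=> Pif x1 y1; have [u u1 <-] := exists_phase_add (f (x, 0)) (f (0, y)).
have -> : f (x, 0) + u * f (0, y) = f (x, u *: y).
  have -> : (x, u *: y) = (x, 0) + u *: (0, y) :> X.
    by rewrite pairZE pairDE scaler0 addr0 add0r.
  by rewrite linearD linearZ.
apply: (le_trans (Pi_rnorm_le Pif _)); apply: rnorm_pair_le => //.
by rewrite rnormZ u1 mul1r.
Qed.

(** The l1-part of [f] contributes at most [rnorm p] at [S (a, b)], so its c0-part must attain its
    norm [rnorm q] at the c0-component of [S (a, b)]. A point of the ball of c0 where a functional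
    attains its norm has modulus 1 at every coordinate that the functional sees. *)
Lemma numerical_radius_coord S (K : R) (a : l1 R) (b : c0 R)
    (f : {linear X -> R[i]^o}) k :
  (forall z, rnorm z <= 1 -> rnorm (S z) <= K) -> numerical_radius S = 1 ->
  Pi ((a, b), f) -> rnorm (f (S (a, b))) = 1 -> f (0, c0_unit R k) != 0 ->
  1 <= rnorm ((S (a, b)).2 k).
Proof.
move=> SK nuS Pif fS1 fk0; set p := f (a, 0); set q := f (0, b).
have [/= ab1 _ _ fab] := Pif.
have a1 : rnorm a <= 1 by rewrite -ab1; exact: (rnorm_fst_le (a, b)).
have b1 : rnorm b <= 1 by rewrite -ab1; exact: (rnorm_snd_le (a, b)).
have pq : rnorm p + rnorm q = 1.
  apply/le_anti; rewrite (Pi_l1_add_c0 Pif)//= -rnormc1 -fab pair_split linearD.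
  exact: rnormD.
(* The point [b] already uses [rnorm q] of the total norm 1, which leaves [rnorm p] for the
   restriction to l1. *)
have fx x : rnorm (f (x, 0)) <= rnorm p * rnorm x.
  have [g gE] : exists g : {linear l1 R -> R[i]^o}, forall x, g x = f (x, 0).
    apply: exists_linear => t x1 x2.
    by rewrite -linearP pairZE pairDE scaler0 addr0.
  rewrite -gE; apply: linear_rnorm_le => x' x1; rewrite gE.
  by have := Pi_l1_add_c0 Pif x1 b1; rewrite -pq lerD2r.
(* For nonzero [p], the functional [f (., 0)] divided by [p] is again a state at [(a, b)], so [nuS]
   bounds it by 1 at [S (a, b)]. *)
have fu : rnorm (f ((S (a, b)).1, 0)) <= rnorm p.
  have [p0|p0] := eqVneq p 0.
    by apply: (le_trans (fx _)); rewrite p0 rnorm0 mul0r.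
  have np : 0 < rnorm p.
    by rewrite lt0r rnorm_ge0 andbT; apply: contra p0 => /eqP/rnorm0_eq0 ->.
  have [g gE] : exists g : {linear X -> R[i]^o}, forall z, g z = p^-1 * f (z.1,
    0).
    apply: exists_linear => t z1 z2; rewrite /=.
    have -> : (t *: z1.1 + z2.1, 0) = t *: (z1.1, 0) + (z2.1, 0) :> X.
      by rewrite pairZE pairDE scaler0 addr0.
    by rewrite linearP mulrDr; congr (_ + _); exact: mulrCA.
  have Pig : Pi ((a, b), g).
    apply: PiP => //; first by rewrite gE mulVf.
    move=> z; rewrite gE rnormcM rnormcV mulrC ler_pdivrMr// mulrC.
    by apply: (le_trans (fx _)); rewrite ler_wpM2l ?rnorm_ge0 ?rnorm_fst_le.
  have := numerical_radius_ub SK Pig.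
  by rewrite nuS gE rnormcM rnormcV mulrC ler_pdivrMr// mul1r.
have fv : rnorm q <= rnorm (f (0, (S (a, b)).2)).
  rewrite -(lerD2l (rnorm p)) pq -fS1.
  rewrite [X in rnorm (f X) <= _](surjective_pairing (S (a, b))).
  rewrite [X in rnorm (f X) <= _]pair_split linearD.
  by apply: (le_trans (rnormD _ _)); rewrite lerD2r.
have Sj j : rnorm ((S (a, b)).2 j) <= 1.
  by rewrite -nuS; apply: coord_le_numerical_radius SK _; rewrite ab1.
rewrite leNgt; apply/negP => Sk1; set v := (S (a, b)).2 in fv Sj Sk1.
(* Here [t] is the room left at coordinate [k]: moving [v] by [t] along e_k with the right phase
   stays in the ball and would raise the value of [f] above [rnorm q]. *)
pose t := 1 - rnorm (v k); have t0 : 0 < t by rewrite subr_gt0.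
have [u u1 fvu] := exists_phase_add (f (0, v)) (t%:C * f (0, c0_unit R k)).
pose v' := v + (u * t%:C) *: c0_unit R k.
have v'1 : rnorm v' <= 1.
  apply: c0_rnorm_le => j; rewrite c0_unit_shiftE; case: eqP => [->|//].
  apply: (le_trans (rnormD _ _)); rewrite rnormcM u1 mul1r.
  by rewrite rnormcR gtr0_norm// addrC subrK.
have := Pi_l1_add_c0 Pif a1 v'1; rewrite -pq lerD2l leNgt => /negP; apply.
have -> : f (0, v') = f (0, v) + u * (t%:C * f (0, c0_unit R k)).
  have -> : (0, v') = (u * t%:C) *: (0, c0_unit R k) + (0, v) :> X.
    by rewrite pairZE pairDE scaler0 addr0 addrC.
  by rewrite linearP addrC mulrA.
rewrite fvu; apply: (le_lt_trans fv); rewrite ltrDl.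
rewrite rnormcM rnormcR gtr0_norm// mulr_gt0// lt0r rnorm_ge0 andbT.
by apply: contra fk0 => /eqP/rnorm0_eq0 ->.
Qed.

(* If |L (a, b)| = 1 = |L| then L (c e_k, b) also has modulus 1 for the unit
   scalar c with a k = |a k| c, since (a, b) is a convex combination of
   (c e_k, b) and a point of the unit ball. *)
Lemma l1_coord_extreme (L : {linear X -> R[i]^o}) (a : l1 R) (b : c0 R) k :
  (forall z, rnorm z <= 1 -> rnorm (L z) <= 1) ->
  rnorm a <= 1 -> rnorm b <= 1 -> a k != 0 -> 1 <= rnorm (L (a, b)) ->
  1 <= rnorm (L (l1_unit R k, 0)) + rnorm (L (0, b)).
Proof.
move=> L1 a1 b1 ak0 Lab; set s := rnorm (a k).
have s0 : 0 < s.
  by rewrite lt0r rnorm_ge0 andbT; apply: contra ak0 => /eqP/rnorm0_eq0 ->.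
have s1 : s <= 1 by exact: le_trans (l1_coord_le _ _) a1.
pose r := a - a k *: l1_unit R k.
have rE j : r j = if j == k then 0 else a j.
  by rewrite /r -scaleNr l1_unit_shiftE; case: eqP => // ->; rewrite subrr.
have nr : rnorm r <= 1 - s.
  apply: l1_rnorm_le => n; rewrite lerBrDr.
  (* The partial sums are extended to length at least [k.+1] so that the term of index [k] can be
     split off. *)
  apply: le_trans (le_trans (l1_psum_le a (maxn n k.+1)) a1).
  have kn : (k < maxn n k.+1)%N by rewrite leq_max leqnn orbT.
  rewrite (bigD1 (Ordinal kn))//= [leRHS]addrC lerD2r.
  apply: (@le_trans _ _ (\sum_(j < maxn n k.+1) rnorm (r j))).
    rewrite -!(big_mkord xpredT (fun j => rnorm (r j))).
    rewrite [leRHS](@big_cat_nat _ _ _ n)//= ?leq_maxl//.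
    by rewrite lerDl sumr_ge0// => j _; exact: rnorm_ge0.
  under [leLHS]eq_bigr do rewrite rE.
  rewrite [leLHS](bigD1 (Ordinal kn))//= eqxx rnorm0 add0r.
  by apply: ler_sum => j _; case: ifP => // _; rewrite rnorm0 rnorm_ge0.
(* The first two terms together are [s] times the point (c e_k, b); the last has norm at most
   [1 - s]. *)
have zE : (a, b) = a k *: (l1_unit R k, 0) + s%:C *: (0, b) + (r, (1 - s)%:C *:
  b) :> X.
  rewrite !pairZE !pairDE !scaler0 addr0 add0r addrC subrK; congr pair.
  rewrite -scalerDl -rmorphD/= addrC subrK.
  by rewrite (_ : 1%:C = 1)// scale1r.
have {}Lab : 1 <= s * rnorm (L (l1_unit R k, 0)) + s * rnorm (L (0, b)) + (1 -
  s).
  apply: (le_trans Lab); rewrite zE !linearD !linearZ.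
  apply: (le_trans (rnormD _ _)); apply: lerD; last first.
    rewrite -[leRHS]mul1r.
    apply: (le_trans (linear_rnorm_le L1 _)); rewrite !mul1r.
    apply: rnorm_pair_le => //; rewrite rnormZ rnormcR ger0_norm ?subr_ge0//.
    by rewrite ler_piMr// subr_ge0.
  apply: (le_trans (rnormD _ _)).
  by rewrite !rnormZ rnormcR (gtr0_norm s0).
by rewrite -(ler_pM2l s0) mulr1 mulrDr; lra.
Qed.

End numerical_radius_l1_c0.

(** * Failure of the BPBp-nu *)

Section failure.
Variable R : realType.
Local Notation X := (l1 R * c0 R)%type.
Implicit Types (x : l1 R) (y : c0 R).

Lemma pair_sum (a : nat -> R[i]) (e : nat -> c0 R) n :
  \sum_(k < n) a k *: (0, e k) = (0, \sum_(k < n) a k *: e k) :> X.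
Proof.
elim: n => [|n IH]; first by rewrite !big_ord0.
by rewrite !big_ord_recr/= IH pairZE pairDE scaler0 addr0.
Qed.

Definition off_diag n x (i : nat) : R[i]^o := \sum_(j < n | j != i :> nat) x j.

Lemma rnorm_off_diag n x i : rnorm (off_diag n x i) <= rnorm x.
Proof.
apply: (le_trans (rnorm_sum _ _ _)); apply: le_trans (l1_psum_le x n).
by rewrite big_mkcond/=; apply: ler_sum => j _; case: ifP => // _;
  exact: rnorm_ge0.
Qed.

Lemma exists_off_diag_op n : exists T : {linear X -> X},
  [/\ forall x y i, (T (x, y)).2 i = if (i < n)%N then off_diag n x i else 0,
      forall z, rnorm (T z) <= rnorm z & compact_op T].
Proof.
have [T TE] : exists T : {linear X -> X}, forall z,
    T z = \sum_(k < n) off_diag n z.1 k *: (0, c0_unit R k).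
  apply: exists_linear => a z z' /=.
  rewrite scaler_sumr -big_split/=; apply: eq_bigr => k _.
  rewrite scalerA -scalerDl; congr (_ *: _).
  by rewrite /off_diag mulr_sumr -big_split.
have T2 z i : (T z).2 i = if (i < n)%N then off_diag n z.1 i else 0.
  by rewrite TE pair_sum [LHS]c0_sumE.
have T1 z : rnorm (T z) <= rnorm z.
  rewrite TE pair_sum; apply: rnorm_pair_le; first by rewrite rnorm0 rnorm_ge0.
  apply: c0_rnorm_le => i; rewrite c0_sumE.
  case: ifP => _; last by rewrite rnorm0 rnorm_ge0.
  exact: le_trans (rnorm_off_diag _ _ _) (rnorm_fst_le _).
exists T; split=> //.
apply: (compact_op_subset
  (@compact_disc_combinations _ _ (fun k => (0, c0_unit R k) : X) n)).
move=> z z1; exists (off_diag n z.1); last exact: TE.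
by move=> k; apply: le_trans (rnorm_off_diag _ _ _) (le_trans (rnorm_fst_le _)
  z1).
Qed.

(** This is the l1-norm of a functional on c0: [g] is tested on the sum of the u_i e_i, with phases
    u_i that make all the terms nonnegative. *)
Lemma sum_coord_le (g : c0 R -> R[i]^o) (K : R) n : linear g ->
  (forall y, rnorm y <= 1 -> rnorm (g y) <= K) ->
  \sum_(i < n) rnorm (g (c0_unit R i)) <= K.
Proof.
move=> lg gK; have [G GE] := exists_linear lg.
have /choice[u uP] : forall i, exists u : R[i]^o,
    rnorm u = 1 /\ u * G (c0_unit R i) = (rnorm (G (c0_unit R i)))%:C.
  by move=> i; have [u] := exists_phase (G (c0_unit R i)); exists u.
have := gK (\sum_(i < n) u i *: c0_unit R i).
rewrite -GE linear_sum (eq_bigr (fun i : 'I_n => (rnorm (g (c0_unit R i)))%:C)).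
  rewrite -rmorph_sum/= rnormcR ger0_norm; last first.
    by rewrite sumr_ge0// => i _; exact: rnorm_ge0.
  apply; apply: c0_rnorm_le => i; rewrite c0_sumE.
  by case: ifP => _; [rewrite (uP i).1|rewrite rnorm0].
by move=> i _; rewrite linearZ [LHS](uP i).2 GE.
Qed.

Lemma l1_c0_not_compact_BPBp_nu : ~ compact_BPBp_nu X.
Proof.
(* Twice below, two quantities less than this constant would have to add up to at least 1; any value
   up to 1/2 would do. *)
move=> /(_ (4^-1)); rewrite invr_gt0 ltr0n invf_lt1 ?ltr1n// => /(_ isT).
move=> [eta eta0 BPB].
(* This choice makes 1/n less than [eta] and [n] at least 2, so that the indices 0 and 1 are both
   available. *)
pose n := (Num.truncn eta^-1).+2; pose h : R := n%:R^-1.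
have h0 : 0 <= h by rewrite invr_ge0.
have h_eta : h < eta.
  rewrite invf_plt ?posrE ?ltr0n// /n -natr1.
  by apply: (lt_trans (truncnS_gt _)); rewrite ltrDl.
have sumh : \sum_(i < n) h = 1.
  by rewrite sumr_const card_ord -mulr_natl divff// pnatr_eq0.
have sumhC : \sum_(i < n) h%:C = 1 :> R[i] by rewrite -rmorph_sum/= sumh.
have [T [T2 T1 cT]] := exists_off_diag_op n.
pose x0 : l1 R := \sum_(k < n) h%:C *: l1_unit R k.
pose y0 : c0 R := \sum_(k < n) 1 *: c0_unit R k.
have x0E k : x0 k = if (k < n)%N then h%:C else 0 by exact: (l1_sumE (fun=>
  h%:C)).
have y0E k : y0 k = if (k < n)%N then 1 else 0 by exact: (c0_sumE (fun=> 1)).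
have [f0 f0E] : exists f0 : {linear X -> R[i]^o}, forall z,
    f0 z = \sum_(i < n) h%:C * z.2 i.
  apply: exists_linear => a z z'.
  rewrite scaler_sumr -big_split; apply: eq_bigr => k _.
  by rewrite linear_c0_coord mulrDr; congr (_ + _); exact: mulrCA.
have f0_unit i : (i < n)%N -> f0 (0, c0_unit R i) = h%:C.
  move=> i_n; rewrite f0E (bigD1 (Ordinal i_n))//= big1 ?addr0 /unit_seq ?eqxx
    ?mulr1//.
  by move=> j ji; rewrite -(inj_eq val_inj)/= in ji; rewrite (negbTE ji) mulr0.
have Pi0 : Pi ((x0, y0), f0).
  apply: PiP.
  - rewrite rnorm_prod/=; have -> : rnorm y0 = 1.
      apply/le_anti/andP; split.
        by apply: c0_rnorm_le => k; rewrite y0E; case: ifP => _;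
          rewrite ?rnormc1 ?rnorm0.
      by have := c0_coord_le y0 0; rewrite y0E/= rnormc1.
    apply/max_idPr; apply: (le_trans (rnorm_sum _ _ _)).
    rewrite -[leRHS]sumh; apply: ler_sum => k _.
    by rewrite rnormZ rnormcR rnorm_l1_unit mulr1 ger0_norm.
  - rewrite f0E -[RHS]sumhC; apply: eq_bigr => i _.
    by rewrite [X in _ * X]y0E ltn_ord mulr1.
  - move=> z; rewrite f0E; apply: (le_trans (rnorm_sum _ _ _)).
    rewrite -[leRHS]mul1r -sumh mulr_suml; apply: ler_sum => i _.
    rewrite rnormcM rnormcR ger0_norm// ler_wpM2l//.
    exact: le_trans (c0_coord_le _ _) (rnorm_snd_le _).
have T1' z : rnorm z <= 1 -> rnorm (T z) <= 1 by exact: le_trans (T1 z).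
have nuT : numerical_radius T = 1.
  have [f fE] : exists f : {linear X -> R[i]^o}, forall z, f z = z.2 1%N.
    exact: exists_linear (linear_c0_coord 1).
  apply: (@numerical_radius_eq _ _ _ _ (l1_unit R 0, c0_unit R 1) f) => //.
    apply: PiP; last 1 first.
    - move=> z; rewrite fE.
      exact: le_trans (c0_coord_le _ _) (rnorm_snd_le _).
    - apply/le_anti/andP; split.
        apply: rnorm_pair_le; first by rewrite rnorm_l1_unit.
        by apply: c0_rnorm_le => k; rewrite /= /unit_seq; case: ifP;
          rewrite ?rnormc1 ?rnorm0.
      by apply: le_trans (rnorm_fst_le _); rewrite /= rnorm_l1_unit.
    - by rewrite fE.
  rewrite fE T2/= /off_diag (bigD1 ord0)//= big1 ?addr0 ?rnormc1//.
  by move=> j /andP[_ j0]; rewrite -(inj_eq val_inj)/= in j0;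
    rewrite /unit_seq (negbTE j0).
have T0 : rnorm (f0 (T (x0, y0))) > 1 - eta.
  (* Each row omits exactly one of the [n] equal entries [h] of [x0], hence gives 1 - h, and [f0]
     averages the rows. *)
  have -> : f0 (T (x0, y0)) = (1 - h)%:C.
    rewrite f0E -[RHS]mul1r -sumhC mulr_suml; apply: eq_bigr => i _.
    rewrite T2 ltn_ord; congr (_ * _).
    rewrite rmorphB/= -[1%:C]sumhC (bigD1 i)//= addrAC subrr add0r.
    by apply: eq_bigr => j _; rewrite x0E ltn_ord.
  by rewrite rnormcR; apply: lt_le_trans (ler_norm _); rewrite ltrD2l ltrN2.
have [S [[a b] [f [cS Pif [nuS fS] [ST xx0 ff0]]]]] := BPB _ _ _ cT Pi0 nuT T0.
have [K SK] := compact_op_bounded cS.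
have [_ cf _ _] := Pif.
have STle z : rnorm z <= 1 -> rnorm (S z - T z) < 4^-1.
  move=> z1; apply: le_lt_trans ST.
  apply: (opnorm_ub (f := S \- T) (K := K + 1)) => // w w1.
  by apply: (le_trans (rnormB _ _)); apply: lerD; [exact: SK|exact: T1'].
have ffle z : rnorm z <= 1 -> rnorm (f z - f0 z) <= opnorm (f \- f0).
  move=> z1; apply: (opnorm_ub (f := f \- f0) (K := 1 + 1)) => // w w1.
  apply: (le_trans (rnormB _ _)).
  by apply: lerD; apply: le_trans w1;
    [exact: Pi_rnorm_le Pif w|exact: Pi_rnorm_le Pi0 w].
have suma : \sum_(i < n) rnorm (a i - h%:C : R[i]^o) < 4^-1.
  apply: le_lt_trans xx0; apply: le_trans (rnorm_fst_le _).
  apply: le_trans (l1_psum_le _ n); apply: ler_sum => i _.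
  have -> : (a - x0) i = a i - x0 i by [].
  by rewrite x0E ltn_ord.
have sumf : \sum_(i < n) rnorm (f (0, c0_unit R i) - h%:C : R[i]^o) < 4^-1.
  apply: le_lt_trans ff0.
  have lin : linear (fun y => f (0, y) - f0 (0, y)).
    move=> t y y'; have -> : (0, t *: y + y') = t *: (0, y) + (0, y') :> X.
      by rewrite pairZE pairDE scaler0 addr0.
    by rewrite (linearP f) (linearP f0) scalerBr opprD addrACA.
  have := @sum_coord_le _ _ n lin; move=> /(_ (opnorm (f \- f0))).
  rewrite (eq_bigr (fun i : 'I_n => rnorm (f (0, c0_unit R i) - h%:C :
    R[i]^o))).
    apply=> y y1; apply: ffle; apply: rnorm_pair_le => //.
    by rewrite rnorm0.
  by move=> i _; rewrite f0_unit.
(* Each index below [n] where [a] or [f] vanishes costs [h] in [suma] or [sumf]. If all of them did,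
   the two sums would total at least n h = 1. *)
have [i [i_n ai fi]] :
    exists i, [/\ (i < n)%N, a i != 0 & f (0, c0_unit R i) != 0].
  apply: contrapT => none.
  have : 1 <= \sum_(i < n) (rnorm (a i - h%:C : R[i]^o) +
                            rnorm (f (0, c0_unit R i) - h%:C : R[i]^o)).
    rewrite -sumh; apply: ler_sum => i _.
    have [ai|ai] := eqVneq (a i) 0.
      by rewrite ai sub0r rnormN rnormcR ger0_norm// lerDl rnorm_ge0.
    have [fi|fi] := eqVneq (f (0, c0_unit R i)) 0.
      by rewrite fi sub0r rnormN rnormcR ger0_norm// lerDr rnorm_ge0.
    by exfalso; apply: none; exists i; split.
  by rewrite big_split/=; move: suma sumf; clear; lra.
have [L LE] : exists L : {linear X -> R[i]^o}, forall z, L z = (S z).2 i.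
  by apply: exists_linear => t z z'; rewrite linearP linear_c0_coord.
have ab1 : rnorm ((a, b) : X) = 1 by case: Pif.
have L12 : 1 <= rnorm (L (l1_unit R i, 0)) + rnorm (L (0, b)).
  apply: (@l1_coord_extreme _ L a b i) => //.
  - by move=> z z1; rewrite LE -nuS; exact: coord_le_numerical_radius SK z1.
  - by rewrite -ab1; exact: (rnorm_fst_le (a, b)).
  - by rewrite -ab1; exact: (rnorm_snd_le (a, b)).
  - by rewrite LE; exact: numerical_radius_coord SK nuS Pif fS fi.
(* This applies to (e_i, 0) because the diagonal of the matrix is zero, and to (0, b) because [T]
   ignores the c0-component. *)
have Lle z : rnorm z <= 1 -> (T z).2 i = 0 -> rnorm (L z) < 4^-1.
  move=> z1 Tz; apply: le_lt_trans (STle _ z1).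
  rewrite LE; have -> : (S z).2 i = (S z - T z).2 i.
    by rewrite [X in (X + _).2]surjective_pairing [RHS]c0_valB Tz subr0.
  exact: le_trans (c0_coord_le _ _) (rnorm_snd_le _).
have L1 : rnorm (L (l1_unit R i, 0)) < 4^-1.
  apply: Lle; first by apply: rnorm_pair_le; rewrite ?rnorm_l1_unit ?rnorm0.
  rewrite T2 i_n /off_diag big1// => j ji.
  by rewrite /= /unit_seq (negbTE ji).
have L2 : rnorm (L (0, b)) < 4^-1.
  apply: Lle.
    by apply: rnorm_pair_le; [rewrite rnorm0|rewrite -ab1;
      exact: (rnorm_snd_le (a, b))].
  by rewrite T2 i_n /off_diag big1.
by move: L12 L1 L2; clear; lra.
Qed.

End failure.

(** * Functionals on l1 given by unimodular sequences *)

Section l1_functionals.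
Variable R : realType.
Implicit Types (x : l1 R).

(** The sum of the series, taken through real and imaginary parts so that results on real series
    apply. *)
Definition l1_total x : R[i]^o :=
  limn (series (fun k => complex.Re (x k))) +i*
  limn (series (fun k => complex.Im (x k))).

Lemma is_cvg_series_Re x : cvgn (series (fun k => complex.Re (x k))).
Proof.
apply: normed_cvg; apply: (series_le_cvg _ _ _ (@l1_cvg _ x)) => [n|n|n].
- exact: normr_ge0.
- exact: rnorm_ge0.
- by rewrite -lecR rnormE; exact: normc_ge_Re.
Qed.

Lemma is_cvg_series_Im x : cvgn (series (fun k => complex.Im (x k))).
Proof.
have -> : (fun k => complex.Im (x k)) =
    (fun k => complex.Re (((- 'i) *: x) k)).
  apply/funext => k; rewrite l1_valZ.
  by rewrite [_ *: _]mulNr mulrC raddfN/= ReiNIm opprK.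
exact: is_cvg_series_Re.
Qed.

Lemma lim_series_lin (a b : R) (u v w : nat -> R) :
  cvgn (series u) -> cvgn (series v) -> cvgn (series w) ->
  limn (series (a *: u + b *: v + w)) =
  a * limn (series u) + b * limn (series v) + limn (series w).
Proof.
move=> cu cv cw; have cau := is_cvg_seriesZ cu (k := a);
  have cbv := is_cvg_seriesZ cv (k := b).
have cab := is_cvg_seriesD cau cbv.
by rewrite (lim_seriesD cab cw) (lim_seriesD cau cbv) !lim_seriesZ.
Qed.

Lemma l1_total_linear : linear l1_total.
Proof.
have ReE (a b c : R[i]) : complex.Re (a * b + c) =
    complex.Re a * complex.Re b + - complex.Im a * complex.Im b + complex.Re c.
  by case: a b c => [a1 a2] [b1 b2] [c1 c2] /=; rewrite mulNr.
have ImE (a b c : R[i]) : complex.Im (a * b + c) =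
    complex.Re a * complex.Im b + complex.Im a * complex.Re b + complex.Im c.
  by case: a b c => [a1 a2] [b1 b2] [c1 c2] /=; rewrite [a2 * b1]mulrC mulrC.
move=> a x y; rewrite /l1_total.
have cR z := @is_cvg_series_Re z; have cI z := @is_cvg_series_Im z.
have -> : (fun k => complex.Re ((a *: x + y) k)) =
    (complex.Re a *: (fun k => complex.Re (x k)) +
     (- complex.Im a) *: (fun k => complex.Im (x k))) +
    (fun k => complex.Re (y k)).
  by apply/funext => k; rewrite l1_valD l1_valZ [LHS]ReE.
have -> : (fun k => complex.Im ((a *: x + y) k)) =
    (complex.Re a *: (fun k => complex.Im (x k)) +
     complex.Im a *: (fun k => complex.Re (x k))) +
    (fun k => complex.Im (y k)).
  by apply/funext => k; rewrite l1_valD l1_valZ [LHS]ImE.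
rewrite !lim_series_lin//.
by apply/eqP; rewrite eq_complex [X in _ == X]ReE [X in _ && (_ == X)]ImE !eqxx.
Qed.

Lemma l1_totalZ a x : l1_total (a *: x) = a * l1_total x.
Proof.
have t0 : l1_total 0 = 0.
  by have := l1_total_linear (-1) 0 0; rewrite scaler0 addr0 scaleN1r addNr.
by have := l1_total_linear a x 0; rewrite t0 !addr0.
Qed.

Lemma l1_total_ge0 x : (forall k, x k = (rnorm (x k))%:C) ->
  l1_total x = (rnorm x)%:C.
Proof.
move=> xk; rewrite /l1_total rnorm_l1E; congr (_ +i* _).
  by congr (limn (series _)); apply/funext => k; rewrite [in LHS]xk.
rewrite (_ : series _ = cst 0) ?lim_cst//.
by apply/funext => n; rewrite /series/= big1// => k _; rewrite xk.
Qed.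

(** After a rotation of [x] the total is real and nonnegative, and real parts are compared with
    moduli term by term. *)
Lemma rnorm_l1_total x : rnorm (l1_total x) <= rnorm x.
Proof.
have [u u1 ux] := exists_phase (l1_total x).
have -> : rnorm (l1_total x) = complex.Re (l1_total (u *: x)).
  by rewrite l1_totalZ ux.
rewrite rnorm_l1E.
apply: (lim_series_le (@is_cvg_series_Re (u *: x)) (@l1_cvg _ x)) => k;
  apply: (le_trans (ler_Re_rnorm _)).
by rewrite l1_valZ rnormZ u1 mul1r.
Qed.

(** Multiplication by [u] is an isometry of l1; it is followed by [l1_total]. The last clause says
    that the norm is attained at sequences whose phases are cancelled by [u]. *)
Lemma exists_l1_functional (u : nat -> R[i]^o) : (forall k, rnorm (u k) = 1) ->
  exists f : {linear l1 R -> R[i]^o},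
    [/\ forall x, rnorm (f x) <= rnorm x, forall j, f (l1_unit R j) = u j &
        forall x, (forall k, u k * x k = (rnorm (x k))%:C) ->
                  f x = (rnorm x)%:C].
Proof.
move=> u1.
have ul1 x : (fun k => u k * x k) \in @l1_seq R.
  rewrite inE /=; under eq_fun do rewrite rnormcM u1 mul1r.
  exact: l1_cvg.
pose m x : l1 R := L1 (ul1 x).
have nm x : rnorm (m x) = rnorm x.
  rewrite !rnorm_l1E; congr (limn (series _)); apply/funext => k.
  by rewrite /= rnormcM u1 mul1r.
have [f fE] : exists f : {linear l1 R -> R[i]^o}, forall x, f x = l1_total (m
  x).
  apply: exists_linear => a x y; rewrite -l1_total_linear; congr l1_total.
  apply/val_inj/funext => k; rewrite /= mulrDr; congr (_ + _).
  exact: mulrCA.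
exists f; split=> [x|j|x ux]; rewrite fE.
- by rewrite -nm rnorm_l1_total.
- have -> : m (l1_unit R j) = u j *: l1_unit R j.
    apply/val_inj/funext => k.
    rewrite [LHS](_ : _ = u j * unit_seq R j k)// [LHS]/= /unit_seq.
    by case: eqP => [->//|_]; rewrite !mulr0.
  rewrite l1_totalZ l1_total_ge0; first by rewrite rnorm_l1_unit mulr1.
  by move=> k; rewrite /= /unit_seq; case: ifP; rewrite ?rnormc1 ?rnorm0.
- rewrite l1_total_ge0 ?nm// => k.
  by rewrite /= ux rnormcR ger0_norm ?rnorm_ge0.
Qed.

End l1_functionals.

(** * Density *)

Section density.
Variable R : realType.
Local Notation X := (l1 R * c0 R)%type.
Implicit Types (x : l1 R) (y : c0 R) (S T : {linear X -> X}).

(** A functional norming the l1-component of [S (l1_unit R j, y)] can be taken unimodular in every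
    coordinate, also where that component vanishes. It then has modulus 1 at e_j, and a rotation of
    (e_j, y) makes it a state. *)
Lemma exists_state_l1 S j y : rnorm y <= 1 ->
  exists (z : X) (f : {linear X -> R[i]^o}), Pi (z, f) /\
    rnorm (S (l1_unit R j, y)).1 <= rnorm (f (S z)).
Proof.
move=> y1; set u := (S (l1_unit R j, y)).1.
have /choice[t tP] : forall k, exists t : R[i]^o,
    rnorm t = 1 /\ t * u k = (rnorm (u k))%:C.
  by move=> k; have [t] := exists_phase (u k); exists t.
have [g [g1 gj gu]] := exists_l1_functional (fun k => (tP k).1).
have [f fE] : exists f : {linear X -> R[i]^o}, forall z, f z = g z.1.
  by apply: exists_linear => a z z'; rewrite -linearP.
have tj1 : rnorm ((t j)^-1 : R[i]^o) = 1 by rewrite rnormcV (tP j).1 invr1.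
exists ((t j)^-1 *: (l1_unit R j, y)), f; split.
  apply: PiP.
  - rewrite rnormZ tj1 mul1r rnorm_prod/= rnorm_l1_unit.
    exact/max_idPl.
  - by rewrite fE linearZ/= gj; apply: mulVf;
      rewrite rnorm_unit_neq0// (tP j).1.
  - by move=> z; rewrite fE; exact: le_trans (g1 _) (rnorm_fst_le _).
rewrite linearZ fE [g _]linearZ rnormZ tj1 mul1r -/u gu.
  by rewrite rnormcR ger0_norm ?rnorm_ge0.
by move=> k; exact: (tP k).2.
Qed.

(** Either the l1-component carries the norm [M], and [exists_state_l1] applies, or the c0-component
    attains it at some coordinate, and [exists_state_coord] applies. *)
Lemma attains_at_l1_unit S (M : R) j y :
  (forall z, rnorm z <= 1 -> rnorm (S z) <= M) -> rnorm y <= 1 ->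
  rnorm (S (l1_unit R j, y)) = M -> attains_numerical_radius S.
Proof.
move=> SM y1 SyM.
suff [z [f [Pif fM]]] : exists (z : X) (f : {linear X -> R[i]^o}),
    Pi (z, f) /\ M <= rnorm (f (S z)).
  exists z, f; split=> //.
  have fSM : rnorm (f (S z)) = M.
    apply/le_anti; rewrite fM andbT; apply: (le_trans (Pi_rnorm_le Pif _)).
    by apply: SM; case: Pif => /= ->.
  by rewrite (numerical_radius_eq SM Pif fSM).
have [M1|M1] := leP M (rnorm (S (l1_unit R j, y)).1).
  have [z [f [Pif fz]]] := exists_state_l1 S j y1.
  by exists z, f; split=> //; exact: le_trans fz.
have M2 : rnorm (S (l1_unit R j, y)).2 = M.
  move: SyM; rewrite rnorm_prod; case: (leP (rnorm _) (rnorm _)) => // _ S1.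
  by rewrite S1 ltxx in M1.
have [k kM] : exists k, rnorm ((S (l1_unit R j, y)).2 k) = M.
  rewrite -M2; apply: c0_rnorm_attained; rewrite M2.
  exact: le_lt_trans (rnorm_ge0 _) M1.
have e1 : rnorm (l1_unit R j) <= 1 by rewrite rnorm_l1_unit.
have [y' [f [Pif fy]]] := exists_state_coord S k e1 y1.
by exists (l1_unit R j, y'), f; split=> //; rewrite -kM.
Qed.

Lemma rnorm_le_l1_unit S (K M : R) :
  (forall z, rnorm z <= 1 -> rnorm (S z) <= K) ->
  (forall j y, rnorm y <= 1 -> rnorm (S (l1_unit R j, y)) <= M) ->
  forall z, rnorm z <= 1 -> rnorm (S z) <= M.
Proof.
move=> SK SM [x y] z1.
have x1 : rnorm x <= 1 by apply: le_trans z1; exact: (rnorm_fst_le (x, y)).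
have y1 : rnorm y <= 1 by apply: le_trans z1; exact: (rnorm_snd_le (x, y)).
(* The point (0, y) is the midpoint of (e_0, y) and -(e_0, -y); it takes up the weight left over
   when the coefficients of [x] sum to less than 1. *)
have S0 : rnorm (S (0, y)) <= M.
  rewrite -(ler_pM2l (ltr0n R 2)).
  have -> : 2 * rnorm (S (0, y)) = rnorm (2%:C *: S (0, y)).
    by rewrite rnormZ rnormcR ger0_norm.
  have -> : 2%:C *: S (0, y) = S (l1_unit R 0, y) - S (l1_unit R 0, - y).
    rewrite -linearZ -linearB/= pairZE scaler0; congr (S _).
    rewrite -[RHS]/((_ - _, _ - _)) subrr opprK.
    by rewrite (_ : 2%:C = 1 + 1) ?scalerDl ?scale1r//; apply/eqP;
      rewrite eq_complex/= addr0 !eqxx.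
  apply: (le_trans (rnormB _ _)); rewrite mulr_natl mulr2n.
  by apply: lerD; apply: SM; rewrite ?rnormN.
(* The phase of [a] is moved from e_k onto [y], which is allowed since [SM] covers the whole ball of
   c0. *)
have Sk (a : R[i]) k :
    rnorm (S (a *: l1_unit R k, (rnorm (a : R[i]^o))%:C *: y)) <= rnorm (a :
      R[i]^o) * M.
  have [u u1 ua] := exists_phase a.
  have E : u *: (a *: l1_unit R k, (rnorm (a : R[i]^o))%:C *: y) =
      (rnorm (a : R[i]^o))%:C *: (l1_unit R k, u *: y) :> X.
    by rewrite !pairZE !scalerA ua [u * _]mulrC.
  have := linearZ_LR S u (a *: l1_unit R k, (rnorm (a : R[i]^o))%:C *: y).
  rewrite E linearZ => /(congr1 rnorm); rewrite !rnormZ u1 mul1r => <-.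
  have -> : rnorm ((rnorm (a : R[i]^o))%:C : R[i]^o) = rnorm (a : R[i]^o).
    by rewrite rnormcR ger0_norm ?rnorm_ge0.
  apply: ler_wpM2l; first exact: rnorm_ge0.
  by apply: SM; rewrite rnormZ u1 mul1r.
have Sn n : rnorm (S (l1_trunc n x, y)) <= M.
  pose s := \sum_(k < n) rnorm (x k).
  have s1 : 0 <= 1 - s by rewrite subr_ge0; exact: le_trans (l1_psum_le _ _) x1.
  have -> : (l1_trunc n x, y) = \sum_(k < n)
      (x k *: l1_unit R k, (rnorm (x k))%:C *: y) + (1 - s)%:C *: (0, y) :> X.
    have -> : \sum_(k < n) (x k *: l1_unit R k, (rnorm (x k))%:C *: y) =
        (l1_trunc n x, s%:C *: y) :> X.
      rewrite /l1_trunc /s; elim: (n) => [|m IH].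
        by rewrite !big_ord0 scale0r.
      by rewrite !big_ord_recr/= IH pairDE rmorphD/= scalerDl.
    rewrite pairZE pairDE scaler0 addr0 -scalerDl -rmorphD/= addrC subrK.
    by rewrite scale1r.
  rewrite linearD linear_sum; apply: (le_trans (rnormD _ _)).
  have -> : M = \sum_(k < n) rnorm (x k) * M + (1 - s) * M.
    by rewrite -mulr_suml -mulrDl addrC subrK mul1r.
  apply: lerD; first by apply: le_trans (rnorm_sum _ _ _) _; exact: ler_sum.
  by rewrite linearZ rnormZ rnormcR ger0_norm// ler_wpM2l.
(* [K] may be 0, and the truncation error below is divided by the bound. *)
have K0 : 0 < K + 1.
  apply: ltr_wpDl => //; apply: le_trans (SK 0 _); first exact: rnorm_ge0.
  by rewrite rnorm0.
apply/ler_addgt0Pr => e e0.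
have [n xn] := l1_trunc_cvg x (divr_gt0 e0 K0).
have -> : (x, y) = (l1_trunc n x, y) + (x - l1_trunc n x, 0) :> X.
  by rewrite pairDE addr0 addrC subrK.
rewrite (linearD S).
apply: (le_trans (rnormD _ _)).
apply: lerD; first exact: Sn.
have SK1 z : rnorm z <= 1 -> rnorm (S z) <= K + 1.
  by move=> /SK /le_trans; apply; rewrite lerDl.
apply: (le_trans (linear_rnorm_le SK1 _)).
rewrite mulrC -ler_pdivlMr//; apply: rnorm_pair_le; first exact: ltW.
by rewrite rnorm0 divr_ge0// ltW.
Qed.

(* Otherwise blocks y_m of the unit ball of c0 supported beyond m have images
   of norm > d which cluster at some w; adding k of them with disjoint supports
   stays in the unit ball, while the image is close to k w. *)
Lemma compact_op_c0_tail T (d : R) : compact_op T -> 0 < d ->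
  exists m, forall y, rnorm y <= 1 -> rnorm (T (0, y - c0_trunc m y)) <= d.
Proof.
move=> cT d0; have [K TK] := compact_op_bounded cT.
have TKy y : rnorm y <= 1 -> rnorm (T (0, y)) <= K.
  by move=> y1; apply/TK/rnorm_pair_le; rewrite ?rnorm0.
have K0 : 0 < K + 1.
  apply: ltr_wpDl => //; apply: le_trans (TKy 0 _); first exact: rnorm_ge0.
  by rewrite rnorm0.
apply: contrapT => noT.
have /choice[v vP] : forall m, exists v : c0 R,
    [/\ forall j, rnorm (v j) <= 1, forall j, (j < m)%N -> v j = 0,
      exists p, forall j, (p <= j)%N -> v j = 0 & d < rnorm (T (0, v))].
  move=> m; apply: contrapT => nov; apply: noT; exists m => y y1.
  rewrite leNgt; apply/negP => Ty; apply: nov.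
  (* This is the excess over [d]. Cutting [y] at a large [p] changes the image by less than this, so
     a finitely supported block still has an image of norm above [d]. *)
  pose e := rnorm (T (0, y - c0_trunc m y)) - d.
  have e0 : 0 < e by rewrite subr_gt0.
  have [p yp] := c0_trunc_cvg y (divr_gt0 e0 K0).
  pose w := c0_trunc p y; exists (w - c0_trunc m w).
  have wE j : (w - c0_trunc m w) j = if (m <= j < p)%N then y j else 0.
    rewrite c0_valB !c0_truncE.
    by case: (ltnP j m) => //= jm; rewrite ?subrr ?subr0.
  split=> [j|j jm||].
  - rewrite wE; case: ifP => _; last by rewrite rnorm0.
    exact: le_trans (c0_coord_le _ _) y1.
  - by rewrite wE leqNgt jm.
  - by exists p => j pj; rewrite wE ltnNge pj andbF.
  pose r := (y - c0_trunc m y) - (w - c0_trunc m w).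
  have nr : rnorm r < e / (K + 1).
    apply: le_lt_trans yp; apply: c0_rnorm_le => j.
    apply: le_trans (c0_coord_le _ j).
    rewrite /r (c0_valB (y - c0_trunc m y)) wE !c0_valB !c0_truncE.
    case: (ltnP j m) => jm /=; first by rewrite !subrr rnorm0 rnorm_ge0.
    by case: (ltnP j p) => jp; rewrite ?subr0 ?subrr ?rnorm0.
  have Tr : rnorm (T (0, r)) < e.
    have TK1 z : rnorm z <= 1 -> rnorm (T z) <= K + 1.
      by move=> /TK /le_trans; apply; rewrite lerDl.
    apply: (le_lt_trans (linear_rnorm_le TK1 _)); rewrite mulrC -ltr_pdivlMr//.
    by rewrite rnorm_prod/= gt_max nr rnorm0 andbT divr_gt0.
  have -> : (0, w - c0_trunc m w) = (0, y - c0_trunc m y) - (0, r) :> X.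
    by rewrite -[RHS]/((_ - _, _ - _)) subrr subKr.
  rewrite linearB; apply: lt_le_trans (le_trans (ler_norm _) (rnorm_dist _ _)).
  by rewrite ltrBrDr addrC -ltrBrDr -/e.
have v1 m : rnorm ((0, v m) : X) <= 1.
  apply: rnorm_pair_le; first by rewrite rnorm0.
  by apply: c0_rnorm_le; have [] := vP m.
have [w wP] := compact_op_cluster cT v1.
have wd : d / 2 + d / 4 <= rnorm w.
  have [m _ wm] := wP (d / 4) (divr_gt0 d0 (ltr0n R 4)) 0%N.
  have [_ _ _ dm] := vP m.
  have := rnormB w (w - T (0, v m)); rewrite subKr.
  have arith (p q r : R) : d < p -> p <= q + r -> r < d / 4 -> d / 2 + d / 4 <=
    q.
    by clear; lra.
  by move=> h; exact: arith dm h wm.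
(* Each new block starts beyond the support [p] of the previous sum, so the norm stays at most 1,
   while each block adds an error of at most d/2. *)
have sums k : exists y p, [/\ rnorm y <= 1, forall j, (p <= j)%N -> y j = 0 &
    rnorm (k%:R%:C *: w - T (0, y)) <= k%:R * (d / 2)].
  elim: k => [|k [y [p [y1 yp wy]]]].
    exists 0, 0%N; split=> //; first by rewrite rnorm0.
    by rewrite scale0r sub0r linear0 rnormN rnorm0 mul0r.
  have [m pm wm] := wP (d / 2) (divr_gt0 d0 (ltr0n R 2)) p.
  have [vm1 vm0 [q vq] _] := vP m.
  exists (y + v m), (maxn p q); split.
  - apply: c0_rnorm_le => j; rewrite c0_valD; have [jm|mj] := ltnP j m.
      by rewrite vm0// addr0 (le_trans (c0_coord_le _ _) y1).
    by rewrite yp ?add0r// (leq_trans pm).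
  - by move=> j; rewrite geq_max c0_valD => /andP[pj qj];
      rewrite yp// vq// addr0.
  have -> : k.+1%:R%:C *: w - T (0, y + v m) =
      (k%:R%:C *: w - T (0, y)) + (w - T (0, v m)).
    have -> : (0, y + v m) = (0, y) + (0, v m) :> X by rewrite pairDE addr0.
    rewrite linearD -natr1 rmorphD/= scalerDl scale1r opprD.
    by rewrite addrACA.
  apply: (le_trans (rnormD _ _)); rewrite -natr1 mulrDl mul1r.
  by apply: lerD => //; exact: ltW.
(* Since [w] has norm at least 3d/4, the [k] blocks force k d/4 <= K; this [k] is chosen to violate
   that. *)
pose k := (Num.truncn (K / (d / 4))).+1.
have [y [p [y1 _ wy]]] := sums k.
have kK : K < k%:R * (d / 4).
  by rewrite -ltr_pdivrMr ?divr_gt0// truncnS_gt.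
have kw : k%:R * rnorm w <= k%:R * (d / 2) + K.
  have -> : k%:R * rnorm w = rnorm (k%:R%:C *: w).
    by rewrite rnormZ rnormcR ger0_norm.
  rewrite -[X in rnorm X](subrK (T (0, y))).
  by apply: (le_trans (rnormD _ _)); apply: lerD => //; exact: TKy.
have := ler_wpM2l (ler0n R k) wd; rewrite mulrDr => kwd.
have := le_trans kwd kw; rewrite lerD2l leNgt => /negP; exact.
Qed.

Lemma l1_c0_compact_NRA_dense : compact_NRA_dense X.
Proof.
(* Truncation and the rank-one term each cost at most [d], for a total of e/2. *)
move=> T cT e e0; pose d := e / 4; have d0 : 0 < d by rewrite divr_gt0.
have [K TK] := compact_op_bounded cT.
have [m Tm] := compact_op_c0_tail cT d0.
have truncP (a : R[i]) y y' :
    c0_trunc m (a *: y + y') = a *: c0_trunc m y + c0_trunc m y'.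
  rewrite scaler_sumr -big_split; apply: eq_bigr => k _ /=.
  by rewrite scalerA -scalerDl.
have trunc1 y : rnorm y <= 1 -> rnorm (c0_trunc m y) <= 1.
  move=> y1; apply: c0_rnorm_le => k; rewrite c0_truncE.
  by case: ifP => _; rewrite ?rnorm0// (le_trans (c0_coord_le _ _)).
pose tr (z : X) : X := (z.1, c0_trunc m z.2).
have tr1 z : rnorm z <= 1 -> rnorm (tr z) <= 1.
  move=> z1; apply: rnorm_pair_le; first exact: le_trans (rnorm_fst_le _) z1.
  by apply: trunc1; exact: le_trans (rnorm_snd_le _) z1.
have trP (a : R[i]) z z' : tr (a *: z + z') = a *: tr z + tr z'.
  by rewrite /tr pairZE pairDE -truncP.
pose A := [set rnorm (T (tr (p.1, p.2))) |
  p in [set p : l1 R * c0 R | exists2 j, p.1 = l1_unit R j & rnorm p.2 <= 1]].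
have A_sup : has_sup A.
  split; first by eexists; exists (l1_unit R 0, 0) => //; exists 0%N;
    rewrite ?rnorm0.
  exists K => _ [[x y] [j /= -> y1] <-]; apply/TK/tr1/rnorm_pair_le => //.
  by rewrite rnorm_l1_unit.
have [_ [[_ y0] [j0 /= -> y01] <-] nuA] := sup_adherent d0 A_sup.
set w := T (tr (l1_unit R j0, y0)) in nuA.
(* The direction of [w] is used so that the perturbation adds exactly [d] to the norm at (e_j0, y0);
   any unit vector serves when [w] is 0. *)
have [g g1 wg] : exists2 g : X, rnorm g = 1 & w = (rnorm w)%:C *: g.
  have [w0|w0] := eqVneq w 0.
    exists (l1_unit R 0, 0); last by rewrite w0 rnorm0 scale0r.
    by rewrite rnorm_prod/= rnorm_l1_unit rnorm0; apply/max_idPl.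
  have nw0 : rnorm w != 0 by apply: contra w0 => /eqP/rnorm0_eq0 ->.
  exists ((rnorm w)^-1%:C *: w).
    by rewrite rnormZ rnormcR ger0_norm ?invr_ge0 ?rnorm_ge0// mulVf.
  by rewrite scalerA -rmorphM/= divff// scale1r.
have [S SE] : exists S : {linear X -> X}, forall z,
    S z = T (tr z) + (d%:C * z.1 j0) *: g.
  apply: exists_linear => a z z'; rewrite trP linearP.
  rewrite linear_l1_coord mulrDr scalerDl scalerDr addrACA.
  by rewrite scalerA mulrCA.
have SK z : rnorm z <= 1 -> rnorm (S z) <= K + d.
  move=> z1; rewrite SE; apply: (le_trans (rnormD _ _)); apply: lerD;
    first exact/TK/tr1.
  rewrite rnormZ g1 mulr1 rnormcM rnormcR gtr0_norm// ler_piMr ?(ltW d0)//.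
  exact: le_trans (l1_coord_le _ _) (le_trans (rnorm_fst_le _) z1).
have cS : compact_op S.
  apply: (compact_op_add (f := tr) cT (@compact_disc_combinations _ _ (fun=>
    d%:C *: g) 1)).
  move=> z z1; split; first exact: tr1.
  exists (fun=> z.1 j0); first move=> _.
    exact: le_trans (l1_coord_le _ _) (le_trans (rnorm_fst_le _) z1).
  by rewrite big_ord1 SE addrAC subrr add0r scalerA mulrC.
(* A compact copy of the ball of c0 as seen by [S], which depends on [y] only through its
   truncation. *)
pose D := disc_combinations (fun k => c0_unit R k) m.
have DP y : rnorm y <= 1 -> D (c0_trunc m y).
  by move=> y1; exists y => // k; exact: le_trans (c0_coord_le _ _) y1.
have D1 y : D y -> rnorm y <= 1.
  move=> [a a1 ->]; apply: c0_rnorm_le => k; rewrite c0_sumE.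
  by case: ifP => _; rewrite ?rnorm0.
have [ys] : exists2 ys, ys \in D & forall y, y \in D ->
    rnorm (S (l1_unit R j0, y)) <= rnorm (S (l1_unit R j0, ys)).
  apply: compact_EVT_max.
  - by exists (c0_trunc m 0); apply: DP; rewrite rnorm0.
  - exact: compact_disc_combinations.
  have cpair : continuous (fun y => (l1_unit R j0, y) : X).
    move=> y; exact: (@cvg_pair _ _ _ (nbhs y) (nbhs (l1_unit R j0)) (nbhs y)
      _ _ _ (fun=> l1_unit R j0) id (@cvg_cst _ _ _ _ _) (@cvg_id _ _)).
  have cntS : continuous S by exact: linear_bounded_op_continuous SK.
  have cntSpair : continuous (fun y => S (l1_unit R j0, y)).
    move=> y; exact: (@continuous_comp _ _ _ _ S y (@cpair y) (@cntS _)).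
  apply: continuous_subspaceT => y.
  exact: (@continuous_comp _ _ _ _ (@rnorm R X) y (@cntSpair y)
    (@rnorm_continuous _ _ _)).
rewrite inE => /D1 ys1 ysmax.
have Strunc j y : S (l1_unit R j, y) = S (l1_unit R j, c0_trunc m y).
  rewrite !SE /tr/=; congr (T (_, _) + _).
  by apply/val_inj/funext => k; rewrite /= !c0_truncE; case: ifP.
set M := rnorm (S (l1_unit R j0, ys)).
have Sj0 y : rnorm y <= 1 -> rnorm (S (l1_unit R j0, y)) <= M.
  by move=> y1; rewrite Strunc; apply/ysmax/mem_set/DP.
have SM : forall z, rnorm z <= 1 -> rnorm (S z) <= M.
  apply: rnorm_le_l1_unit SK _ => j y y1.
  (* The other columns are unchanged, hence bounded by the supremum of [A], which is less than
     [rnorm w + d], the norm of [S] at (e_j0, y0). *)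
  have [->|jj0] := eqVneq j j0; first exact: Sj0.
  apply: le_trans (Sj0 _ y01).
  have -> : S (l1_unit R j0, y0) = (rnorm w + d)%:C *: g.
    by rewrite SE/= -/w /unit_seq eqxx mulr1 {1}wg rmorphD/= scalerDl.
  rewrite rnormZ g1 mulr1 rnormcR; apply: le_trans (ler_norm _).
  apply: le_trans (ltW _); last by rewrite -ltrBlDr; exact: nuA.
  have -> : S (l1_unit R j, y) = T (tr (l1_unit R j, y)).
    by rewrite SE/= /unit_seq eq_sym (negbTE jj0) mulr0 scale0r addr0.
  apply: ub_le_sup; first by case: A_sup.
  by exists (l1_unit R j, y) => //; exists j.
exists S; split=> //; first exact: attains_at_l1_unit SM ys1 erefl.
apply: (@le_lt_trans _ _ (d + d)); last by rewrite /d; move: e0; clear; lra.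
apply: opnorm_le => z z1; rewrite /= SE addrAC.
have z21 : rnorm z.2 <= 1 by exact: le_trans (rnorm_snd_le _) z1.
apply: (le_trans (rnormD _ _)); apply: lerD.
  have -> : T z = T (tr z) + T (0, z.2 - c0_trunc m z.2).
    transitivity (T (tr z + (0, z.2 - c0_trunc m z.2))); last exact: linearD.
    by congr (T _); rewrite /tr pairDE addr0 addrC subrK -surjective_pairing.
  by rewrite opprD addrA subrr sub0r rnormN; exact: Tm.
rewrite rnormZ g1 mulr1 rnormcM rnormcR gtr0_norm// ler_piMr ?(ltW d0)//.
exact: le_trans (l1_coord_le _ _) (le_trans (rnorm_fst_le _) z1).
Qed.

End density.

Theorem proposition5p6 (R : realType) :
  compact_NRA_dense (l1 R * c0 R)%type /\ ~ compact_BPBp_nu (l1 R * c0 R)%type.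
Proof.
split; first exact: l1_c0_compact_NRA_dense.
exact: l1_c0_not_compact_BPBp_nu.
Qed.
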